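(* Let $k\in\mathbb C$ with $\Re(k)<0$ and let $\delta>0$. Let $f:\mathbb Q\to\mathbb C$ satisfy $f(x)=f(x+1)$ for all $x\in\mathbb Q\setminus[-1,0]$, and let $h:\mathbb R\setminus\{0\}\to\mathbb C$ be such that $h(x)=f(x)-|x|^{-k}f(-1/x)$ for all $x\in\mathbb Q\cap([-1,1]\setminus\{0\})$. Assume that $$\sup_{\substack{x,y\in\mathbb R\setminus\{0\}\\ |x-y|<e^{-\varepsilon^{\delta-1}},\ |x|>2\varepsilon}}|h(x)-h(y)|=o(1)\quad(\varepsilon\to0^+),\qquad h(x)=O\big(e^{|x|^{\delta-1}}\big)\ \text{ for all } x\in[-1,1]\setminus\{0\}.$$ Then there is a set $X\subset\mathbb R\setminus\mathbb Q$ of full Lebesgue measure such that for every $x\in X$ the limit $$f^\dagger(x):=\lim_{j\to\infty}f(x_j)$$ exists, where $x_j=[a_0(x);a_1(x),\dots,a_j(x)]$ are the convergents of the continued fraction expansion of $x$. If in addition $h$ is bounded, then for every $x\in X$ the limit $\lim_{\mathbb Q\ni y\to x}f(y)$ exists and equals $f^\dagger(x)$. In general, for any $\varepsilon>0$ there is a subset $X_\varepsilon\subset X$, invariant under $x\mapsto x+1$, with $\mathrm{meas}(X_\varepsilon\cap[0,1])\geq1-\varepsilon$, such that the restriction $f^\dagger|_{X_\varepsilon}$ is continuous on $X_\varepsilon$ equipped with the subspace topology. In particular $f^\dagger$ is Lebesgue-measurable.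
   Context: $\mathrm{meas}$ denotes Lebesgue measure. For $x\in\mathbb R$, $x=[a_0;a_1,a_2,\dots]$ is its regular continued fraction expansion ($a_0\in\mathbb Z$, $a_i\geq1$ for $i\ge1$). *)

(* Defs.v *)
From HB Require Import structures.
From mathcomp Require Import all_boot all_order all_algebra.
From mathcomp Require Import all_classical all_reals all_analysis.
From mathcomp Require Import complex.
Set Implicit Arguments. Unset Strict Implicit. Unset Printing Implicit Defensive.
Import Order.TTheory GRing.Theory Num.Theory.
Local Open Scope ring_scope.
Local Open Scope complex_scope.

Definition cpow_pos (R : realType) (t : R) (z : R[i]) : R[i] :=
  (expR (complex.Re z * ln t))%:C *
  (cos (complex.Im z * ln t) +i* sin (complex.Im z * ln t)).

Fixpoint cf_tail (R : realType) (x : R) (n : nat) : R :=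
  match n with
  | 0 => x
  | n'.+1 => (cf_tail x n' - (Num.floor (cf_tail x n'))%:~R)^-1
  end.

Definition cf_digit (R : realType) (x : R) (n : nat) : int :=
  Num.floor (cf_tail x n).

Fixpoint cf_eval (a : nat -> int) (i n : nat) : rat :=
  match n with
  | 0 => (a i)%:~R
  | n'.+1 => (a i)%:~R + (cf_eval a i.+1 n')^-1
  end.

Definition convergent (R : realType) (x : R) (j : nat) : rat :=
  cf_eval (cf_digit x) 0 j.

(* Main.v *)
Require Import Defs.
From HB Require Import structures.
From mathcomp Require Import all_boot all_order all_algebra.
From mathcomp Require Import all_classical all_reals all_analysis.
From mathcomp Require Import complex ring lra.
Import Order.TTheory GRing.Theory Num.Theory.
Import numFieldNormedType.Exports.
Local Open Scope ring_scope.
Local Open Scope classical_set_scope.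
Local Open Scope complex_scope.
Set Implicit Arguments.
Unset Strict Implicit.

(* Let [z_l] be the fractional part of the [l]-th complete quotient of [x].
   Periodicity and reciprocity, applied alternately at positive and negative
   arguments, expand [f q], for [q] rational, as a sum of terms
   [(z_0 ... z_(l-1))^(-k) * h (+- z_l)] plus a remainder.  Since
   [z_l z_(l+1) <= 1/2], the factor decays exponentially in [l], so the sum is
   dominated as soon as [|h (+- z_l)|] is at most a small exponential in [l];
   this always holds for [h] bounded, and otherwise it follows from
   [z_l >= tau_l] for a suitable summable sequence [tau].  As [h] and the Gauss
   map are continuous at irrationals, the values of [f] at dominated rationals
   converging to an irrational [x] form a Cauchy family.

   By Borel-Cantelli almost every [x] satisfies [z_l >= tau_l] eventually,
   because [{z_l < t}] has measure [O(t)] uniformly in [l].  The convergents of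
   such an [x] are dominated, since their partial quotients are those of [x].
   On the set where [z_l >= tau_l] for all [l >= L] the domination is uniform,
   which gives continuity there, and measurability on the union over [L]. *)

(** * Continued fractions *)

Section ContinuedFractions.
Variable R : realType.
Implicit Types (x y t : R) (n m i j l : nat).

(** The orbit of the fractional part of [x] under the Gauss map. Once it reaches 0 it stays there,
    because [0^-1 = 0]. *)
Definition frc x n : R := cf_tail x n - (cf_digit x n)%:~R.

Lemma frc_ge0 x n : 0 <= frc x n.
Proof. by rewrite /frc subr_ge0 /cf_digit; exact: floor_le. Qed.

Lemma frc_lt1 x n : frc x n < 1.
Proof.
by have := floorD1_gt (cf_tail x n); rewrite /frc /cf_digit intrD ltrBlDl.
Qed.

Lemma cf_tailE x n : cf_tail x n = (cf_digit x n)%:~R + frc x n.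
Proof. by rewrite /frc addrC subrK. Qed.

Lemma cf_tailS x n : cf_tail x n.+1 = (frc x n)^-1.
Proof. by []. Qed.

Lemma cf_tail_gt1 x n : frc x n != 0 -> 1 < cf_tail x n.+1.
Proof.
move=> z; rewrite cf_tailS invf_gt1 ?frc_lt1//.
by rewrite lt_neqAle eq_sym z frc_ge0.
Qed.

Lemma cf_digit_ge1 x n : frc x n != 0 -> 1 <= cf_digit x n.+1.
Proof. by move=> /cf_tail_gt1 z; rewrite /cf_digit floor_ge_int ltW. Qed.

(** If [frc x n] is nonzero, the product equals [z / (d + z)] with [z = frc x n.+1 < 1] and a digit
    [d >= 1]. *)
Lemma frc_mul_half x n : frc x n * frc x n.+1 <= 2^-1.
Proof.
have [->|z0] := eqVneq (frc x n) 0; first by rewrite mul0r invr_ge0.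
have t1 := cf_tail_gt1 z0.
have : (1 : R) <= (cf_digit x n.+1)%:~R by rewrite ler1z cf_digit_ge1.
have f1 := frc_lt1 x n.+1; have := cf_tailE x n.+1.
have -> : frc x n = (cf_tail x n.+1)^-1 by rewrite cf_tailS invrK.
move=> e1 d1; rewrite mulrC ler_pdivrMr; lra.
Qed.

Lemma prod_frc_ge0 x m : 0 <= \prod_(i < m) frc x i.
Proof. by apply: prodr_ge0 => i _; exact: frc_ge0. Qed.

(** Induction by steps of two: a pair of consecutive factors contributes at most [1/2 <= (3/4)^2],
    and the constant [4/3] pays for an unpaired factor. *)
Lemma prod_frc_le x m : \prod_(i < m) frc x i <= 4 / 3 * (3 / 4) ^+ m.
Proof.
elim/ltn_ind: m => -[|[|m]] IH.
- by rewrite big_ord0 expr0; lra.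
- by rewrite big_ord1 expr1; have := frc_lt1 x 0; rewrite (_ : (ord0 : nat) = 0%N)//; lra.
rewrite 2!big_ord_recr/= -mulrA 2!exprS.
have := IH m (leqW (leqnn _)); have := frc_mul_half x m; have := prod_frc_ge0 x m.
set P := \prod_(i < m) _; set Q := _ * _; set E := _ ^+ m => P0 Q1 PE.
have : P * Q <= P * 2^-1 by rewrite ler_wpM2l.
have : 0 <= E by rewrite exprn_ge0.
lra.
Qed.

Lemma rational_int (z : int) : rational (z%:~R : R).
Proof. by exists z%:~R => //; rewrite ratr_int. Qed.

Lemma rationalN x : rational x -> rational (- x).
Proof. by move=> [q _ <-]; exists (- q) => //; rewrite rmorphN. Qed.

Lemma rationalD x y : rational x -> rational y -> rational (x + y).
Proof. by move=> [q _ <-] [r _ <-]; exists (q + r) => //; rewrite rmorphD. Qed.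

Lemma rationalV x : rational x -> rational x^-1.
Proof. by move=> [q _ <-]; exists q^-1 => //; rewrite fmorphV. Qed.

Lemma rational_ratr (q : rat) : rational (ratr q : R).
Proof. by exists q. Qed.

Lemma rational_cf_tail x n : rational x -> rational (cf_tail x n).
Proof.
move=> xq; elim: n => // n IH; rewrite cf_tailS; apply: rationalV.
by apply: rationalD => //; apply: rationalN; apply: rational_int.
Qed.

Lemma rational_frc x n : rational x -> rational (frc x n).
Proof.
move=> xq; apply: rationalD; first exact: rational_cf_tail.
by apply: rationalN; apply: rational_int.
Qed.

Lemma irrational_cf_tail x n : irrational x -> irrational (cf_tail x n).
Proof.
move=> xi; elim: n => // n IH; rewrite cf_tailS => /rationalV.
rewrite invrK => fq; apply: IH; rewrite cf_tailE.
by apply: rationalD => //; exact: rational_int.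
Qed.

Lemma irrational_frc x n : irrational x -> irrational (frc x n).
Proof.
move=> xi fq; apply: (irrational_cf_tail (n := n) xi); rewrite cf_tailE.
by apply: rationalD => //; exact: rational_int.
Qed.

Lemma irrational_neq0 x : irrational x -> x != 0.
Proof.
by move=> xi; apply/eqP => x0; apply: xi; rewrite x0; exact: (rational_int 0).
Qed.

Lemma frc_neq0 x n : irrational x -> frc x n != 0.
Proof. by move=> xi; apply: irrational_neq0; exact: irrational_frc. Qed.

Lemma frc_gt0 x n : irrational x -> 0 < frc x n.
Proof. by move=> xi; rewrite lt_neqAle eq_sym frc_neq0// frc_ge0. Qed.

Lemma cf_tailDz x (z : int) n : cf_tail (x + z%:~R) n.+1 = cf_tail x n.+1.
Proof.
elim: n => [|n IH].
  rewrite 2!cf_tailS /frc /cf_digit/= floorDrz ?rpred_int// rmorphD/= intrKfloor.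
  by congr (_ ^-1); ring.
by rewrite cf_tailS /frc /cf_digit IH.
Qed.

Lemma frcDz x (z : int) n : frc (x + z%:~R) n = frc x n.
Proof. by apply: invr_inj; rewrite -!cf_tailS cf_tailDz. Qed.

Lemma cf_tail_shift x n : cf_tail x n.+1 = cf_tail (frc x 0)^-1 n.
Proof. by elim: n => // n IH; rewrite cf_tailS /frc /cf_digit IH. Qed.

Lemma frc_shift x n : frc x n.+1 = frc (frc x 0)^-1 n.
Proof. by rewrite /frc /cf_digit cf_tail_shift. Qed.

(** * Continuity of the complete quotients at irrational points *)

Lemma near_floor t : irrational t ->
  \forall s \near t, Num.floor s = Num.floor t.
Proof.
move=> ti.
have l1 : (Num.floor t)%:~R < t.
  rewrite lt_neqAle floor_le andbT; apply/eqP => e.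
  by apply: ti; rewrite -e; exact: rational_int.
have l2 := floorD1_gt t.
near=> s; apply/eqP; rewrite floor_eq; apply/andP; split.
  by apply: ltW; near: s; exact: lt_nbhsr.
by near: s; exact: lt_nbhsl.
Unshelve. all: by end_near. Qed.

Lemma near_cf_digit x n : irrational x -> {for x, continuous (@cf_tail R ^~ n)} ->
  \forall y \near x, cf_digit y n = cf_digit x n.
Proof.
by move=> xi cx; exact: (cx _ (near_floor (irrational_cf_tail (n := n) xi))).
Qed.

(** Digits are locally constant near an irrational point, so each step of the expansion is locally a
    translation followed by an inversion away from 0. *)
Lemma continuous_cf_tail x n : irrational x ->
  {for x, continuous (@cf_tail R ^~ n)}.
Proof.
move=> xi; elim: n => [|n IH]; first exact: cvg_id.
have H : \forall y \near x, (cf_digit y n)%:~R = (cf_digit x n)%:~R :> R.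
  have F := near_cf_digit xi IH.
  by near=> y; congr (_%:~R); near: y.
have C : {for x, continuous (frc ^~ n)}.
  rewrite /continuous_at /frc; apply: (@cvgB _ _ _ (nbhs x) _ (@cf_tail R ^~ n)).
    exact: IH.
  exact: (cvg_near_cst _ H).
have -> : @cf_tail R ^~ n.+1 = fun y => (frc y n)^-1 by [].
by apply: (@cvgV _ _ (nbhs x) _ (frc ^~ n)); [exact: frc_neq0|exact: C].
Unshelve. all: by end_near. Qed.

Lemma continuous_frc x n : irrational x -> {for x, continuous (frc ^~ n)}.
Proof.
move=> xi; have -> : frc ^~ n = fun y => (@cf_tail R y n.+1)^-1.
  by apply/funext => y; rewrite cf_tailS invrK.
apply: (@cvgV _ _ (nbhs x) _ (@cf_tail R ^~ n.+1)).
  by apply: irrational_neq0; exact: irrational_cf_tail.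
exact: (continuous_cf_tail (n := n.+1) xi).
Qed.

(* The denominators of the complete quotients of a rational strictly decrease. *)
Lemma frc_terminates x n : rational x -> exists2 m, (n <= m)%N & frc x m = 0.
Proof.
move=> /(rational_cf_tail n); rewrite rationalP => -[a [b]].
elim/ltn_ind: b => b IH in n a *.
(* A zero denominator stands for the quotient 0, by the convention on inverses; the orbit has then
   already stopped. *)
have [->|b0] := posnP b.
  rewrite invr0 mulr0 => e; exists n => //.
  by rewrite /frc /cf_digit e floor0 subr0.
have bR : (0 : R) < b%:R by rewrite ltr0n.
have bZ : b%:Z != 0 by rewrite eqz_nat -lt0n.
move=> e; pose r := (a %% b)%Z.
have r0 : 0 <= r by rewrite modz_ge0.
have rb : r < b by rewrite ltz_pmod.
have ae : a%:~R = (a %/ b)%Z%:~R * b%:R + r%:~R :> R.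
  by rewrite {1}(divz_eq a b) rmorphD rmorphM.
have te : cf_tail x n = (a %/ b)%Z%:~R + r%:~R / b%:R.
  by rewrite e ae mulrDl mulfK// gt_eqF.
have d : cf_digit x n = (a %/ b)%Z.
  rewrite /cf_digit; apply: floor_def.
  apply/andP; split; first by rewrite te lerDl divr_ge0 ?ler0z// ltW.
  rewrite te intrD ltrD2l ltr_pdivrMr// mul1r.
  by rewrite -[b%:R]/(b%:Z%:~R) ltr_int.
have fe : frc x n = r%:~R / b%:R by rewrite /frc te d addrAC subrr add0r.
have [r00|rn0] := eqVneq r 0; first by exists n; rewrite // fe r00 mul0r.
have rE : r = `|r|%N by rewrite gez0_abs.
have [m nm m0] : exists2 m, (n.+1 <= m)%N & frc x m = 0.
  apply: (IH `|r|%N _ n.+1 b%:Z); first by rewrite -ltz_nat -rE.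
  by rewrite cf_tailS fe invf_div [in LHS]rE.
by exists m => //; exact: ltnW.
Qed.


(** * Convergents of an irrational number *)

Section Convergents.
Variables (x : R) (xi : irrational x).
(** The finite continued fraction with digits [a_i, ..., a_(i+m)] of [x], a truncation of
    [cf_tail x i]. *)
Let c i m : R := ratr (cf_eval (cf_digit x) i m).

Let c0E i : c i 0 = (cf_digit x i)%:~R.
Proof. by rewrite /c /= ratr_int. Qed.

Let cSE i m : c i m.+1 = (cf_digit x i)%:~R + (c i.+1 m)^-1.
Proof. by rewrite /c /= rmorphD fmorphV/= ratr_int. Qed.

Let digit_ge1 i : 1 <= (cf_digit x i.+1)%:~R :> R.
Proof. by rewrite ler1z cf_digit_ge1// frc_neq0. Qed.

Let c_ge1 i m : 1 <= c i.+1 m.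
Proof.
elim: m i => [|m IH] i; first by rewrite c0E digit_ge1.
rewrite cSE (le_trans (digit_ge1 i))// lerDl invr_ge0.
by rewrite (le_trans ler01)// IH.
Qed.

Let c_le i m : c i m <= (cf_digit x i)%:~R + 1.
Proof.
case: m => [|m]; first by rewrite c0E lerDl ler01.
rewrite cSE lerD2l invf_le1 ?c_ge1//.
by rewrite (lt_le_trans ltr01)// c_ge1.
Qed.

(** Since [|1/s - 1/t| = |s - t| / (s t)] with [s >= 1] and [1/t = frc x i], each level multiplies
    the error by at most [frc x i]. *)
Let dist_c i m : `|c i m - cf_tail x i| <= \prod_(j < m) frc x (i + j).
Proof.
elim: m i => [|m IH] i.
  rewrite big_ord0 c0E [cf_tail x i]cf_tailE opprD addrA subrr add0r normrN.
  by rewrite ger0_norm ?frc_ge0// ltW// frc_lt1.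
rewrite big_ord_recl cSE [cf_tail x i]cf_tailE addn0.
have -> : frc x i = (cf_tail x i.+1)^-1 by rewrite cf_tailS invrK.
have t1 : 1 < cf_tail x i.+1 by rewrite cf_tail_gt1// frc_neq0.
have c1 := c_ge1 i m.
set t := cf_tail x i.+1 in t1 *; set s := c i.+1 m in c1 *.
rewrite opprD addrACA subrr add0r.
have t0 : 0 < t by rewrite (lt_trans ltr01).
have s0 : 0 < s by rewrite (lt_le_trans ltr01).
have -> : s^-1 - t^-1 = t^-1 * (s^-1 * (t - s)) by field; lra.
have tV : 0 <= t^-1 by rewrite invr_ge0 ltW.
have sV : 0 <= s^-1 by rewrite invr_ge0 ltW.
rewrite normrM (ger0_norm tV); apply: ler_wpM2l => //.
rewrite normrM (ger0_norm sV) distrC.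
apply: (@le_trans _ _ `|s - t|).
  by rewrite ler_piMl// invf_le1.
apply: (le_trans (IH i.+1)); apply: ler_prod => j _.
by rewrite frc_ge0/= addSnnS.
Qed.

Lemma dist_convergent j : `|ratr (convergent x j) - x| <= 4 / 3 * (3 / 4) ^+ j.
Proof. exact: le_trans (dist_c 0 j) (prod_frc_le x j). Qed.

(** Until its orbit vanishes, a convergent has the digits of [x], so its complete quotients are the
    truncations of those of [x]. *)
Lemma cf_tail_convergent j n :
  (forall i, (i < n)%N -> frc (ratr (convergent x j) : R) i != 0) ->
  (n <= j)%N /\
  cf_tail (ratr (convergent x j) : R) n = ratr (cf_eval (cf_digit x) n (j - n)).
Proof.
elim: n => [|n IH] H; first by rewrite subn0.
have [nj te] := IH (fun i ni => H i (leqW ni)).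
have fn := H n (leqnn _).
have : (n < j)%N.
  rewrite ltn_neqAle nj andbT; apply: contra_neq fn => nj'.
  by rewrite /frc /cf_digit te nj' subnn /= ratr_int intrKfloor subrr.
move=> nj'; split => //.
move: te; rewrite -/(c n (j - n)) -/(c n.+1 (j - n.+1)).
rewrite -(subnSK nj') cSE; set s := c n.+1 _ => te.
have s1 : 1 <= s by exact: c_ge1.
(* The ambiguous ending of a finite expansion: if the next quotient is exactly 1, the current one is
   an integer, and its fractional part vanishes against the assumption. *)
rewrite le_eqVlt in s1; case/orP: s1 => [/eqP s1|s1].
  move: fn; rewrite /frc /cf_digit te -s1 invr1 -[1](_ : 1%:~R = 1)// -intrD.
  by rewrite intrKfloor subrr eqxx.
have s0 : 0 < s by rewrite (lt_trans ltr01).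
have de : cf_digit (ratr (convergent x j) : R) n = cf_digit x n.
  rewrite [LHS]/cf_digit te; apply: floor_def.
  by rewrite lerDl invr_ge0 ltW//= intrD ltrD2l invf_lt1.
by rewrite cf_tailS /frc de te addrAC subrr add0r invrK.
Qed.

(** Transfers lower bounds on the orbit of [x] to its convergents: with [a] the next digit, the next
    quotient of the convergent is at most [a + 1 <= 2 a], while that of [x] is at least [a]. *)
Lemma frc_convergent_ge j n :
  (forall i, (i <= n)%N -> frc (ratr (convergent x j) : R) i != 0) ->
  frc x n / 2 <= frc (ratr (convergent x j) : R) n.
Proof.
move=> /(@cf_tail_convergent j n.+1)[_].
rewrite -/(c n.+1 (j - n.+1)) => te; have := c_le n.+1 (j - n.+1); have := c_ge1 n (j - n.+1).
rewrite -te => t1 t2.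
have -> : frc (ratr (convergent x j) : R) n = (cf_tail (ratr (convergent x j) : R) n.+1)^-1.
  by rewrite cf_tailS invrK.
have -> : frc x n = (cf_tail x n.+1)^-1 by rewrite cf_tailS invrK.
have := cf_tailE x n.+1; have := frc_ge0 x n.+1; have := digit_ge1 n.
move=> d1 f0 xe; rewrite -invfM lef_pV2 ?posrE; lra.
Qed.

End Convergents.
End ContinuedFractions.

(** * Measure of the preimages of [0, t) under iterates of the Gauss map *)

Section GaussMapMeasure.
Variable R : realType.
Implicit Types (x y t p q : R) (n l : nat).
Local Notation leb := (@lebesgue_measure R).

Lemma le_lebesgue (A B : set R) : A `<=` B -> (leb A <= leb B)%E.
Proof. by move=> AB; exact: le_outer_measure. Qed.

Lemma lebesgue_ge0 (A : set R) : (0 <= leb A)%E.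
Proof. exact: outer_measure_ge0. Qed.

(** Subadditivity of the outer measure, hence valid for arbitrary sets such as images under Moebius
    maps. *)
Lemma lebesgue_cover (A : set R) (F : nat -> set R) (u : nat -> R) (M : R) :
  A `<=` \bigcup_n F n -> (forall n, (leb (F n) <= (u n)%:E)%E) ->
  (forall n, \sum_(i < n) u i <= M) -> (leb A <= M%:E)%E.
Proof.
move=> AF Fu uM; apply: (le_trans (le_lebesgue AF)).
have H : (leb (\bigcup_n F n) <= \sum_(n <oo) leb (F n))%E.
  exact: outer_measure_sigma_subadditive.
apply: (le_trans H).
have u0 n : (0 <= (u n)%:E)%E by exact: le_trans (lebesgue_ge0 _) (Fu n).
apply: (@le_trans _ _ (\sum_(n <oo) (u n)%:E)%E).
  by apply: lee_nneseries => [n _ _|n _]; [exact: lebesgue_ge0|exact: Fu].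
apply: lime_le; first exact: is_cvg_nneseries.
by near=> n; rewrite big_mkord sumEFin lee_fin.
Unshelve. all: by end_near. Qed.

Definition gauss_lt l t : set R :=
  [set y | [/\ 0 < y, y < 1, irrational y & frc y l < t]].

Let mobius p p' q q' y : R := (p + p' * y) / (q + q' * y).

(* A Moebius branch of an iterate of the Gauss map distorts lengths by a factor
   at most 2; the right-hand side is [4 t] times the length of the image of
   [0, 1].  The cylinders [1 / (n + z)] of the next level have denominators
   [q n + q', q], and their lengths telescope. *)
Lemma lebesgue_mobius_gauss_lt l p p' q q' t :
  0 < q -> 0 <= q' -> q' <= q -> 0 <= t ->
  (leb (mobius p p' q q' @` gauss_lt l t) <=
   (4 * t * (`|p' * q - p * q'| / (q * (q + q'))))%:E)%E.
Proof.
elim: l p p' q q' => [|l IH] p p' q q' q0 q'0 q'q t0.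
  pose d := t * (`|p' * q - p * q'| / q ^+ 2).
  have d0 : 0 <= d by rewrite mulr_ge0// divr_ge0// exprn_ge0// ltW.
  (* The branch sends 0 to [p / q] and moves [y < t] away from it by at most [d]. *)
  have S : mobius p p' q q' @` gauss_lt 0 t `<=` `[p / q - d, p / q + d].
    move=> _ [y [y0 y1 _ yt] <-] /=; rewrite in_itv/= -ler_distl.
    have yE : frc y 0 = y.
      rewrite /frc /cf_digit/= (@floor_def _ y 0) ?subr0//.
      by rewrite (ltW y0).
    rewrite yE in yt.
    have D0 : 0 < q + q' * y by rewrite ltr_wpDr// mulr_ge0// ltW.
    have -> : mobius p p' q q' y - p / q = y * ((p' * q - p * q') / (q * (q + q' * y))).
      by rewrite /mobius; field; rewrite !gt_eqF.
    rewrite normrM (ger0_norm (ltW y0)) ler_pM ?(ltW y0) ?(ltW yt)//.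
    rewrite normrM normfV ler_wpM2l// (@ger0_norm _ (q * _)); last first.
      by rewrite mulr_ge0 ?ltW.
    rewrite lef_pV2 ?posrE ?mulr_gt0// ?exprn_gt0//.
    by rewrite expr2 ler_wpM2l ?(ltW q0)// lerDl mulr_ge0// ltW.
  apply: (le_trans (le_lebesgue S)).
  rewrite lebesgue_measure_itv/= lte_fin.
  case: ifPn => _; rewrite ?EFinN -?EFinB lee_fin; last first.
    by rewrite !mulr_ge0// invr_ge0 mulr_ge0 ?addr_ge0// ltW.
  rewrite (_ : _ - _ = 2 * t * (`|p' * q - p * q'| / q ^+ 2)); last by rewrite /d; ring.
  (* Here [q' <= q] gives [q + q' <= 2 q]; this is the distortion factor 2. *)
  have key : (q ^+ 2)^-1 <= 2 * (q * (q + q'))^-1.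
    rewrite -[2](invrK 2) -invfM lef_pV2 ?posrE ?exprn_gt0//.
      by rewrite expr2 mulrCA ler_wpM2l ?(ltW q0)//; lra.
    by rewrite mulr_gt0 ?invr_gt0// mulr_gt0// ltr_wpDr.
  have A0 : 0 <= 2 * t * `|p' * q - p * q'| by rewrite !mulr_ge0.
  have := ler_wpM2l A0 key; rewrite [4 * t * _]mulrA mulrA; lra.
pose D := `|p' * q - p * q'|.
pose Q n : R := q * n.+1%:R + q'.
have Q0 n : 0 < Q n by rewrite ltr_wpDr// mulr_gt0.
have QS n : Q n + q = Q n.+1 by rewrite /Q -[n.+2%:R]natr1; ring.
(* Substituting [y = 1 / (n.+1 + z)] into the branch gives this Moebius map in [z], with the same
   determinant up to sign. *)
pose F n := mobius (p * n.+1%:R + p') p (Q n) q @` gauss_lt l t.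
apply: (@lebesgue_cover _ F (fun n => 4 * t * (D / (Q n * Q n.+1)))).
- move=> _ [y [y0 y1 yi yt] <-].
  have yE : frc y 0 = y.
    by rewrite /frc /cf_digit/= (@floor_def _ y 0) ?subr0// (ltW y0).
  have f0 : frc y 0 != 0 by rewrite yE gt_eqF.
  have := cf_digit_ge1 f0; case dE : (cf_digit y 1) => [[|n]|//] // _.
  have := cf_tailE y 1; rewrite cf_tailS yE dE => yVE.
  exists n => //; exists (frc y 1).
    split; [exact: frc_gt0|exact: frc_lt1|exact: irrational_frc|].
    suff -> : frc (frc y 1) l = frc y l.+1 by [].
    have -> : frc y l.+1 = frc y^-1 l by rewrite frc_shift yE.
    by rewrite yVE (addrC _ (frc y 1)) frcDz.
  have yE' : y = (n.+1%:R + frc y 1)^-1 by rewrite -[LHS]invrK yVE.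
  have z0 := frc_gt0 1 yi.
  rewrite /mobius [in RHS]yE'; set z := frc y 1 in z0 *.
  have n0 : (0 : R) < n.+1%:R + z by rewrite addr_gt0.
  rewrite /Q; move: n.+1%:R n0 => m n0; field.
  have n1 := mulr_gt0 q0 n0.
  by rewrite !gt_eqF// ltr_wpDr.
- move=> n; have := IH (p * n.+1%:R + p') p (Q n) q (Q0 n) (ltW q0) _ t0.
  rewrite QS (_ : `|_ - _| = D); first apply.
    rewrite /Q -[n.+1%:R]natr1 mulrDr mulr1.
    have : 0 <= q * n%:R by rewrite mulr_ge0// ltW.
    by lra.
  by rewrite /D -normrN /Q; congr `|_|; ring.
- move=> n.
  have T0 : 0 <= 4 * t * (D / q) by rewrite !mulr_ge0 ?invr_ge0 ?(ltW q0) ?normr_ge0.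
  (* Telescoping, as [q / (Q i * Q i.+1) = 1 / Q i - 1 / Q i.+1]. *)
  have sumE m : \sum_(i < m) (4 * t * (D / (Q i * Q i.+1))) =
      4 * t * (D / q) * ((Q 0)^-1 - (Q m)^-1).
    elim: m => [|m IHm]; first by rewrite big_ord0 subrr mulr0.
    rewrite big_ord_recr/= IHm -QS.
    move: (Q 0%N) (Q m) (Q0 0%N) (Q0 m) => a b a0 b0; field.
    by rewrite !gt_eqF ?addr_gt0.
  rewrite sumE.
  rewrite (_ : 4 * t * (D / (q * (q + q'))) = 4 * t * (D / q) * (Q 0)^-1); last first.
    by rewrite /Q mulr1 invfM !mulrA.
  by rewrite ler_wpM2l// gerBl invr_ge0 ltW.
Qed.

(** Translation by [a] is the Moebius branch with determinant 1 and denominators [q = 1],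
    [q' = 0]. *)
Lemma lebesgue_gauss_lt (a : R) l t : 0 <= t ->
  (leb [set x : R | [/\ a < x, x < a + 1, irrational (x - a) &
     frc (x - a) l < t]%R] <= (4 * t)%:E)%E.
Proof.
move=> t0; have := @lebesgue_mobius_gauss_lt l a 1 1 0 t ltr01 (lexx _) ler01 t0.
rewrite mulr0 subr0 mulr1 normr1 addr0 mulr1 divr1 mulr1; apply: le_trans.
apply: le_lebesgue => x/= [ax xa xi xt]; exists (x - a).
  by split => //; rewrite ?subr_gt0// ltrBlDl.
by rewrite /mobius mul1r mul0r addr0 divr1 addrC subrK.
Qed.

End GaussMapMeasure.

(** * Borel-Cantelli sets of slowly shrinking Gauss orbits *)

Section FullMeasure.
Variable R : realType.
Implicit Types (x y : R) (n l L : nat).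
Local Notation leb := (@lebesgue_measure R).

Lemma countable_rational : countable (@rational R).
Proof. exact: sub_countable (card_image_le _ _) (countableP _). Qed.

Lemma measurable_rational : measurable (@rational R).
Proof.
apply: countable_measurable; last exact: countable_rational.
by move=> x; exact: measurable_set1.
Qed.

Lemma measurable_irrational : measurable (@irrational R).
Proof. by apply: measurableC; exact: measurable_rational. Qed.

Lemma measurable_fun_within (D : set R) (g : R -> R) : measurable D ->
  (forall x, D x -> forall e : R, 0 < e -> exists d : R, 0 < d /\
     forall y, D y -> `|y - x| < d -> `|g y - g x| < e) ->
  measurable_fun D g.
Proof.
move=> mD gc; apply: measurable_realfun.subspace_continuous_measurable_fun => //.
apply/subspace_continuousP => x Dx; apply/cvgrPdist_lt => e e0.
have [d [d0 H]] := gc x Dx e e0.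
apply/nbhs_ballP; exists d => //= y; rewrite /ball/= distrC => yx Dy.
by rewrite distrC; exact: H.
Qed.

Lemma measurable_frc n : measurable_fun (@irrational R) (fun x => frc x n).
Proof.
apply: measurable_fun_within; first exact: measurable_irrational.
move=> x xi e e0.
have /cvgrPdist_lt/(_ e e0) := continuous_frc (n := n) xi.
move=> /nbhs_ballP[d /= d0 H]; exists d; split => // y _ yx.
by rewrite distrC; apply: H; rewrite /ball/= distrC.
Qed.

Let unit_itv (m : int) : set R := `[m%:~R, m%:~R + 1].

Variable tau : nat -> R.
Hypothesis tau0 : forall l, 0 <= tau l.
Hypothesis tau_tail : forall e : R, 0 < e -> exists L, forall n,
  \sum_(i < n) tau (L + i) <= e.

(** The index is shifted because the thresholds control the terms of positive index in the expansion
    of [f]. *)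
Definition frc_ge L : set R :=
  [set x | irrational x /\ forall l, (L <= l)%N -> tau l <= frc x l.+1].

Lemma measurable_frc_ge L : measurable (frc_ge L).
Proof.
have -> : frc_ge L = \bigcap_l (irrational `&`
    [set x | (L <= l)%N -> tau l <= frc x l.+1]).
  apply/seteqP; split => x; first by move=> [xi H] l _; split => //; exact: H.
  by move=> H; split => [|l]; [have [] := H 0%N I|have [_] := H l I; apply].
apply: bigcapT_measurable => l.
have [Ll|lL] := leqP L l; last first.
  rewrite (_ : _ `&` _ = irrational); first exact: measurable_irrational.
  by apply/seteqP; split => x; [case|move=> xi; split].
rewrite (_ : [set x | _] = (fun x => frc x l.+1) @^-1` `[tau l, +oo[); last first.
  by apply/seteqP; split => x /=; rewrite in_itv/= andbT => H; [exact: H|move=> _].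
by apply: measurable_frc; [exact: measurable_irrational|exact: measurable_itv].
Qed.

Lemma frc_geD1 L x : frc_ge L x <-> frc_ge L (x + 1).
Proof.
have E l : frc (x + 1) l = frc x l by rewrite -[1]/(1%:~R : R) frcDz.
split=> -[xi H]; split.
- move=> xq; apply: xi; rewrite -(addrK 1 x).
  by apply: rationalD => //; exact: (rational_int _ (-1)).
- by move=> l; rewrite E; exact: H.
- by move=> xq; apply: xi; apply: rationalD => //; exact: (rational_int _ 1).
- by move=> l; rewrite -E; exact: H.
Qed.

Lemma lebesgue_frc_lt (e : R) : 0 < e -> exists L, forall m : int,
  (leb (unit_itv m `\` frc_ge L) <= e%:E)%E.
Proof.
move=> e0; have [|L HL] := tau_tail (e := e / 4); first by rewrite divr_gt0.
exists L => m.
(* Index 0 collects the null set of rationals, index [l.+1] the points violating threshold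
   [L + l]. *)
pose F n : set R := if n is l.+1 then
  [set x : R | [/\ m%:~R < x, x < m%:~R + 1, irrational (x - m%:~R) &
     frc (x - m%:~R) (L + l).+1 < tau (L + l)]] else rational.
pose u n : R := if n is l.+1 then 4 * tau (L + l) else 0.
apply: (@lebesgue_cover _ _ F u).
- move=> x []; rewrite /unit_itv/= in_itv/= => /andP[mx xm] nE.
  have [xq|xi] := pselect (rational x); first by exists 0%N.
  have zi (z : int) : x != z%:~R.
    by apply/eqP => xz; apply: xi; rewrite xz; exact: rational_int.
  have [l Ll tl] : exists2 l, (L <= l)%N & frc x l.+1 < tau l.
    apply: contrapT => H; apply: nE; split => // l Ll.
    by rewrite leNgt; apply/negP => tl; apply: H; exists l.
  exists (l - L).+1 => //=; rewrite subnKC// -mulrNz frcDz; split => //.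
  + by rewrite lt_neqAle eq_sym zi.
  + by rewrite lt_neqAle xm andbT -[1]/(1%:~R : R) -intrD zi.
  + move=> xq; apply: xi; rewrite -[x](subrK (m%:~R : R)) -mulrNz.
    by apply: rationalD => //; exact: rational_int.
- case=> [|l] /=; last exact: lebesgue_gauss_lt.
  by rewrite countable_lebesgue_measure0//; exact: countable_rational.
- case=> [|n]; first by rewrite big_ord0 ltW.
  rewrite big_ord_recl/= add0r -mulr_sumr mulrC -ler_pdivlMr//.
  exact: HL.
Qed.

Lemma lebesgue_frc_ge01 (e : R) : 0 < e -> exists L,
  ((1 - e)%:E <= leb (frc_ge L `&` `[0%R, 1%R]))%E.
Proof.
move=> e0; have [L /(_ 0)] := lebesgue_frc_lt e0; rewrite /unit_itv add0r => H.
exists L; have m01 : measurable (`[0%R, 1%R] : set R) by exact: measurable_itv.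
have m1 : leb `[0%R, 1%R] = 1%E.
  by rewrite lebesgue_measure_itv/= lte_fin ltr01 -EFinB subr0.
have : (1 = leb (`[0%R, 1%R] `\` frc_ge L) + leb (frc_ge L `&` `[0%R, 1%R]))%E.
  rewrite -m1 setIC; exact: (measureDI lebesgue_measure m01 (measurable_frc_ge L)).
move: H; set a := leb _; set b := leb _ => ae ab.
have b0 : (0 <= b)%E by exact: lebesgue_ge0.
have a0 : (0 <= a)%E by exact: lebesgue_ge0.
case: a b ae ab b0 a0 => [a| |] [b| |]//=; rewrite ?leey// lee_fin => ae -[] ab _ _.
by rewrite lee_fin; lra.
Qed.

Lemma lebesgue_setC_frc_ge : leb (~` \bigcup_L frc_ge L) = 0%E.
Proof.
set X := \bigcup_L _.
have X0 (m : int) : (leb (unit_itv m `\` X) <= 0)%E.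
  apply/lee_addgt0Pr => e e0; rewrite add0e.
  have [L /(_ m)] := lebesgue_frc_lt e0; apply: le_trans; apply: le_lebesgue.
  by apply: setDS => x xE; exists L.
apply/eqP; rewrite eq_le lebesgue_ge0 andbT.
pose F n : set R :=
  if unpickle n is Some m then unit_itv m `\` X else set0.
apply: (@lebesgue_cover _ _ F (fun=> 0)).
- move=> x Xx; exists (pickle (Num.floor x)) => //; rewrite /F pickleK; split => //.
  by rewrite /unit_itv/= in_itv/= floor_le -[1]/(1%:~R : R) -intrD ltW// floorD1_gt.
- by move=> n; rewrite /F; case: unpickle => // ; rewrite measure0.
- by move=> n; rewrite big1.
Qed.

End FullMeasure.

(** * Summable thresholds adapted to the growth of [h] *)

Section Thresholds.
Variable R : realType.
Implicit Types (n l L : nat).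

(* The tail telescopes: [l.+1^-(1+s) <= (l^-s - l.+1^-s) / s]. *)
Lemma powR_telescope (s : R) l : 0 < s -> (0 < l)%N ->
  s * (l.+1%:R `^ (- (1 + s))) <= l%:R `^ (- s) - l.+1%:R `^ (- s).
Proof.
move=> s0 l0.
have lR : (0 : R) < l%:R by rewrite ltr0n.
have SR : (0 : R) < l.+1%:R by rewrite ltr0n.
have -> : l.+1%:R `^ (- (1 + s)) = l.+1%:R `^ (- s) * l.+1%:R^-1 :> R.
  rewrite (_ : - (1 + s) = - s + -1); last by ring.
  rewrite powRD; last by rewrite (gt_eqF SR) implybT.
  by rewrite powR_inv1// ltW.
have -> : l%:R `^ (- s) = l.+1%:R `^ (- s) * expR (s * (ln l.+1%:R - ln l%:R)) :> R.
  by rewrite /powR !gt_eqF// -expRD; congr expR; ring.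
rewrite mulrCA -[X in _ <= _ - X]mulr1 -mulrBr ler_wpM2l ?powR_ge0//.
(* By [1 + u <= expR u] it remains to see [1 / l.+1 <= ln (l.+1 / l)], which is [ln (1 + v) <= v] at
   [v = - 1 / l.+1]. *)
rewrite lerBrDl; apply: le_trans (expR_ge1Dx _).
rewrite lerD2l ler_wpM2l ?(ltW s0)//.
have -> : ln l.+1%:R - ln l%:R = - ln (l%:R / l.+1%:R) :> R.
  by rewrite ln_div ?posrE// opprB.
have -> : l%:R / l.+1%:R = 1 + - l.+1%:R^-1 :> R.
  by rewrite -natr1; field; rewrite natr1 gt_eqF.
rewrite lerNr; apply: le_ln1Dx.
by rewrite ltrN2 invf_lt1// -[1]/(1%:R) ltr_nat ltnS.
Qed.

Lemma powR_lower_sum (c s e : R) : 0 <= c -> 0 < s -> 0 < e ->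
  exists L, forall n, \sum_(i < n) c * (L + i).+1%:R `^ (- (1 + s)) <= e.
Proof.
(* Once [L ^ s >= A], the telescoped tail is at most [c / (s A) <= e]; [c + 1] keeps [A] positive
   when [c = 0]. *)
move=> c0 s0 e0; pose A := (c + 1) / (s * e).
have c1 : 0 < c + 1 by rewrite ltr_wpDl.
have A0 : 0 < A by rewrite divr_gt0// mulr_gt0.
pose L := (Num.trunc (A `^ s^-1)).+1; exists L => n.
have L0 : (0 : R) < L%:R by rewrite ltr0n.
have LA : A <= L%:R `^ s.
  have AE : A = (A `^ s^-1) `^ s by rewrite -powRrM mulVf ?gt_eqF// powRr1// ltW.
  rewrite AE; apply: ge0_ler_powR; rewrite ?nnegrE ?powR_ge0 ?(ltW s0) ?(ltW L0)//.
  by rewrite ltW// truncnS_gt.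
have H m : s * \sum_(i < m) c * (L + i).+1%:R `^ (- (1 + s)) <=
    c * (L%:R `^ (- s) - (L + m)%:R `^ (- s)).
  elim: m => [|m IH]; first by rewrite big_ord0 mulr0 addn0 subrr mulr0.
  rewrite big_ord_recr/= mulrDr addnS.
  have Lm : (0 < L + m)%N by [].
  by have := ler_wpM2l c0 (powR_telescope s0 Lm); lra.
have {}H := H n; have p0 := powR_ge0 ((L + n)%:R : R) (- s).
have LsV : L%:R `^ (- s) <= A^-1 by rewrite powRN lef_pV2 ?posrE ?powR_gt0.
have cA : c * A^-1 <= s * e.
  rewrite /A invf_div mulrCA ler_piMr ?mulr_ge0 ?(ltW s0) ?(ltW e0)//.
  by rewrite ler_pdivrMr// mul1r lerDl ler01.
rewrite -(ler_pM2l s0); apply: (le_trans H); apply: le_trans cA.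
by rewrite ler_wpM2l// (le_trans _ LsV)// gerBl.
Qed.

(* [tau l] is the value of [v] at which [(v / 2) ^ (- r) = a l.+1]. *)
Lemma summable_thresholds (a r : R) : 0 < a -> 0 < r -> r < 1 ->
  exists tau : nat -> R, [/\ forall l, 0 <= tau l,
    (forall e, 0 < e -> exists L, forall n, \sum_(i < n) tau (L + i)%N <= e) &
    (forall l v, 0 < v -> tau l / 2 <= v -> v `^ (- r) <= a * l.+1%:R)].
Proof.
(* The thresholds decay like [l.+1 ^ (- 1 / r)]; they are summable because [r < 1] makes [s]
   positive. *)
move=> a0 r0 r1; pose s := r^-1 - 1.
have s0 : 0 < s by rewrite subr_gt0 invf_gt1.
pose c := 2 * a `^ (- r^-1).
have c0 : 0 <= c by rewrite mulr_ge0// powR_ge0.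
exists (fun l => c * l.+1%:R `^ (- (1 + s))); split.
- by move=> l; rewrite mulr_ge0// powR_ge0.
- by move=> e e0; exact: powR_lower_sum.
- move=> l v v0; have al : 0 < a * l.+1%:R by rewrite mulr_gt0.
  have -> : c * l.+1%:R `^ (- (1 + s)) / 2 = (a * l.+1%:R) `^ (- r^-1).
    rewrite /c /s (addrC 1) subrK powRM ?(ltW a0)//.
    by rewrite -!mulrA mulrCA [_ / 2]mulrC mulVKf.
  move=> H.
  have {}H : (a * l.+1%:R)^-1 <= v `^ r.
    have := ge0_ler_powR (ltW r0) _ _ H.
    rewrite !nnegrE powR_ge0 (ltW v0) => /(_ isT isT).
    by rewrite -powRrM mulNr mulVf ?gt_eqF// powR_inv1 ?(ltW al).
  by rewrite powRN -[X in _ <= X]invrK lef_pV2 ?posrE ?powR_gt0 ?invr_gt0.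
Qed.

End Thresholds.

(** * Continuity of complex-valued functions *)

Section RealContinuity.
Variables (R : realType) (g1 g2 : R -> R) (x : R).
Hypotheses (c1 : {for x, continuous g1}) (c2 : {for x, continuous g2}).

Lemma continuous_sub : {for x, continuous (fun y => g1 y - g2 y)}.
Proof. exact: (@cvgB _ _ _ (nbhs x) _ g1 g2 _ _ c1 c2). Qed.

Lemma continuous_mul : {for x, continuous (fun y => g1 y * g2 y)}.
Proof. exact: (@cvgM _ _ (nbhs x) _ g1 g2 _ _ c1 c2). Qed.

Lemma continuous_div : g2 x != 0 -> {for x, continuous (fun y => g1 y / g2 y)}.
Proof.
move=> g20; exact: (@cvgM _ _ (nbhs x) _ g1 _ _ _ c1 (@cvgV _ _ (nbhs x) _ g2 _ g20 c2)).
Qed.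

Lemma continuous_opp : {for x, continuous (fun y => - g1 y)}.
Proof. exact: (@cvgN _ _ _ (nbhs x) _ g1 _ c1). Qed.

End RealContinuity.

(** * Limits, continuity and powers with a real-valued complex norm *)

Section ComplexLimits.
Variable R : realType.
Implicit Types (x y e : R) (u v : R -> R[i]) (z : R[i]).
Local Notation nm := (@Normc.normc R).

Lemma normcR_lt z e : (`|z| < e%:C) = (nm z < e).
Proof. by rewrite -ltcR. Qed.

Lemma normcR_le z e : (`|z| <= e%:C) = (nm z <= e).
Proof. by rewrite -lecR. Qed.

Lemma normcR_ge0 z : 0 <= nm z.
Proof. by case: z => a b; exact: sqrtr_ge0. Qed.

Lemma normcR_add z1 z2 : nm (z1 + z2) <= nm z1 + nm z2.
Proof. exact: (le_normcD (z1 : Rcomplex R) z2). Qed.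

Lemma normcR_opp z : nm (- z) = nm z.
Proof. exact: (normcN (z : Rcomplex R)). Qed.

Lemma normcR_sub z1 z2 : nm (z1 - z2) = nm (z2 - z1).
Proof. by rewrite -normcR_opp opprB. Qed.

Lemma normcR_dist_trans z1 z2 z3 : nm (z1 - z3) <= nm (z1 - z2) + nm (z2 - z3).
Proof. by have := normcR_add (z1 - z2) (z2 - z3); rewrite addrA subrK. Qed.

Lemma normcR_Re z : `|complex.Re z| <= nm z.
Proof. by rewrite -lecR; exact: normc_ge_Re. Qed.

Lemma normcR_Im z : `|complex.Im z| <= nm z.
Proof.
case: z => a b /=; rewrite -sqrtr_sqr ler_wsqrtr// lerDr.
exact: sqr_ge0.
Qed.

Lemma normcR_le_ReIm z : nm z <= `|complex.Re z| + `|complex.Im z|.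
Proof.
case: z => a b /=; rewrite -[leRHS]ger0_norm ?addr_ge0// -sqrtr_sqr.
rewrite ler_wsqrtr// sqrrD !real_normK ?num_real//.
by rewrite addrAC lerDl mulrn_wge0 ?mulr_ge0.
Qed.

(** The real and imaginary parts are 1-Lipschitz, so each gives a real Cauchy sequence. *)
Lemma complex_complete (u : nat -> R[i]) :
  (forall e, 0 < e -> exists N, forall i j, (N <= i)%N -> (N <= j)%N ->
     nm (u i - u j) < e) ->
  exists l, forall e, 0 < e -> exists N, forall j, (N <= j)%N -> nm (u j - l) < e.
Proof.
move=> uC.
have cvg_part (p : R[i] -> R) : (forall z1 z2, `|p z1 - p z2| <= nm (z1 - z2)) ->
    exists l, forall e, 0 < e -> exists N, forall j, (N <= j)%N -> `|p (u j) - l| < e.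
  move=> pnm.
  have /cvg_ex[l ul] : cvgn (p \o u).
    apply: cauchy_cvg; apply/cauchy_ballP => e e0.
    have [N HN] := uC e e0.
    exists ([set p (u i) | i in [set i | (N <= i)%N]], [set p (u i) | i in [set i | (N <= i)%N]]).
      by split; exists N => // i /= Ni; exists i.
    move=> [a b] /= [[i Ni <-] [j Nj <-]]; rewrite /ball/=.
    exact: le_lt_trans (pnm _ _) (HN _ _ Ni Nj).
  exists l => e e0; move/cvgrPdist_lt: ul => /(_ e e0)[N _ HN].
  by exists N => j Nj; rewrite distrC; exact: HN.
have [a Ha] : exists l, forall e, 0 < e -> exists N, forall j, (N <= j)%N ->
    `|complex.Re (u j) - l| < e.
  by apply: cvg_part => -[a b] [c d]; exact: (normcR_Re ((a +i* b) - (c +i* d))).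
have [b Hb] : exists l, forall e, 0 < e -> exists N, forall j, (N <= j)%N ->
    `|complex.Im (u j) - l| < e.
  by apply: cvg_part => -[c b] [c' d]; exact: (normcR_Im ((c +i* b) - (c' +i* d))).
exists (a +i* b) => e e0.
have e2 : 0 < e / 2 by rewrite divr_gt0.
have [N1 H1] := Ha _ e2; have [N2 H2] := Hb _ e2.
exists (maxn N1 N2) => j; rewrite geq_max => /andP[/H1 h1 /H2 h2].
apply: (le_lt_trans (normcR_le_ReIm _)); rewrite [e]splitr.
by case: (u j) h1 h2 => c d /= h1 h2; exact: ltrD.
Qed.

Definition ccont u x := forall e, 0 < e -> \forall y \near x, nm (u y - u x) < e.

Lemma ccontD u v x : ccont u x -> ccont v x -> ccont (fun y => u y + v y) x.
Proof.
move=> uc vc e e0; have e2 : 0 < e / 2 by rewrite divr_gt0.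
near=> y; rewrite opprD addrACA [e]splitr; apply: (le_lt_trans (normcR_add _ _)).
by apply: ltrD; near: y; [exact: uc|exact: vc].
Unshelve. all: by end_near. Qed.

Lemma ccontN u x : ccont u x -> ccont (fun y => - u y) x.
Proof. by move=> uc e /uc; apply: filterS => y; rewrite -opprD normcR_opp. Qed.

Lemma ccont_cst z x : ccont (fun=> z) x.
Proof.
by move=> e e0; near=> y; rewrite subrr Normc.normc0.
Unshelve. all: by end_near. Qed.

Lemma ccontM u v x : ccont u x -> ccont v x -> ccont (fun y => u y * v y) x.
Proof.
move=> uc vc e e0; pose M := nm (u x) + nm (v x) + 1.
have M1 : 1 <= M by rewrite lerDr addr_ge0 ?normcR_ge0.
have M0 : 0 < M by rewrite (lt_le_trans ltr01).
pose d := Num.min 1 (e / (2 * M)).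
have d0 : 0 < d by rewrite lt_min ltr01 divr_gt0// mulr_gt0.
near=> y.
have uy : nm (u y - u x) < d by near: y; exact: uc.
have vy : nm (v y - v x) < d by near: y; exact: vc.
have -> : u y * v y - u x * v x =
    (u y - u x) * v x + (u x + (u y - u x)) * (v y - v x) by ring.
apply: (le_lt_trans (normcR_add _ _)); rewrite !Normc.normcM.
have A : nm (u y - u x) * nm (v x) <= d * nm (v x) by rewrite ler_wpM2r ?normcR_ge0// ltW.
have uy1 : nm (u x + (u y - u x)) <= nm (u x) + 1.
  apply: (le_trans (normcR_add _ _)); rewrite lerD2l (le_trans (ltW uy))//.
  by rewrite ge_min lexx.
have B : nm (u x + (u y - u x)) * nm (v y - v x) <= (nm (u x) + 1) * d.
  by apply: ler_pM => //; rewrite ?normcR_ge0// ltW.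
apply: (@le_lt_trans _ _ (d * M)); first by rewrite /M; lra.
have : d * M <= e / (2 * M) * M by rewrite ler_wpM2r ?(ltW M0)// ge_min lexx orbT.
rewrite (_ : e / (2 * M) * M = e / 2); last by field; rewrite gt_eqF.
by move=> H; apply: (le_lt_trans H); lra.
Unshelve. all: by end_near. Qed.

Lemma ccont_comp u (g : R -> R) x :
  {for x, continuous g} -> ccont u (g x) -> ccont (fun y => u (g y)) x.
Proof. by move=> gc uc e /uc; exact: gc. Qed.

Lemma ccont_near u v x : (\forall y \near x, u y = v y) -> ccont v x -> ccont u x.
Proof.
move=> uv vc e e0; have ux := nbhs_singleton uv; rewrite ux.
near=> y; rewrite (_ : u y = v y); last by near: y.
by near: y; exact: vc.
Unshelve. all: by end_near. Qed.

Lemma ccont_sum (u : nat -> R -> R[i]) x n :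
  (forall l, (l < n)%N -> ccont (u l) x) -> ccont (fun y => \sum_(l < n) u l y) x.
Proof.
elim: n => [|n IH] uc.
  by apply: (@ccont_near _ (fun=> 0)); [near=> y; rewrite big_ord0|exact: ccont_cst].
apply: (@ccont_near _ (fun y => \sum_(l < n) u l y + u n y)).
  by near=> y; rewrite big_ord_recr.
by apply: ccontD; [apply: IH => l ln; apply: uc; exact: leqW|exact: uc].
Unshelve. all: by end_near. Qed.

Lemma ccont_prod (u : nat -> R -> R[i]) x n :
  (forall l, (l < n)%N -> ccont (u l) x) -> ccont (fun y => \prod_(l < n) u l y) x.
Proof.
elim: n => [|n IH] uc.
  by apply: (@ccont_near _ (fun=> 1)); [near=> y; rewrite big_ord0|exact: ccont_cst].
apply: (@ccont_near _ (fun y => (\prod_(l < n) u l y) * u n y)).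
  by near=> y; rewrite big_ord_recr.
by apply: ccontM; [apply: IH => l ln; apply: uc; exact: leqW|exact: uc].
Unshelve. all: by end_near. Qed.

Lemma ccont_ReIm u x : {for x, continuous (fun y => complex.Re (u y))} ->
  {for x, continuous (fun y => complex.Im (u y))} -> ccont u x.
Proof.
move=> /cvgrPdist_lt cR /cvgrPdist_lt cI e e0.
have e2 : 0 < e / 2 by rewrite divr_gt0.
near=> y; apply: (le_lt_trans (normcR_le_ReIm _)); rewrite [e]splitr.
have : `|complex.Re (u x) - complex.Re (u y)| < e / 2 by near: y; exact: cR.
have : `|complex.Im (u x) - complex.Im (u y)| < e / 2 by near: y; exact: cI.
rewrite distrC => h1; rewrite distrC => h2.
by move: h1 h2; case: (u y) => a b; case: (u x) => c d /= h1 h2; exact: ltrD.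
Unshelve. all: by end_near. Qed.

Lemma cpow_posE (t : R) z : cpow_pos t z =
  (expR (complex.Re z * ln t) * cos (complex.Im z * ln t)) +i*
  (expR (complex.Re z * ln t) * sin (complex.Im z * ln t)).
Proof. by rewrite /cpow_pos; apply/eqP; rewrite eq_complex/= !mul0r subr0 addr0 !eqxx. Qed.

Lemma normcR_cpow_pos (t : R) z : 0 < t -> nm (cpow_pos t z) = t `^ complex.Re z.
Proof.
move=> t0; rewrite cpow_posE /= !exprMn -mulrDr cos2Dsin2 mulr1 sqrtr_sqr.
by rewrite ger0_norm ?expR_ge0// /powR gt_eqF.
Qed.

Lemma cpow_posM (s t : R) z : 0 < s -> 0 < t ->
  cpow_pos (s * t) z = cpow_pos s z * cpow_pos t z.
Proof.
move=> s0 t0; rewrite !cpow_posE lnM ?posrE// !mulrDr expRD cosD sinD.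
by apply/eqP; rewrite eq_complex/=; apply/andP; split; apply/eqP; ring.
Qed.

Lemma cpow_pos1 z : cpow_pos (1 : R) z = 1.
Proof. by rewrite cpow_posE ln1 !mulr0 expR0 cos0 sin0 mulr1 mulr0. Qed.

Lemma ccont_cpow_pos z (t : R) : 0 < t -> ccont (fun s => cpow_pos s z) t.
Proof.
move=> t0.
have cln (g : R -> R) (a : R) : continuous g ->
    {for t, continuous (fun s => g (a * ln s))}.
  move=> gc; apply: (@continuous_comp _ _ _ (fun s => a * ln s) g); last exact: gc.
  by apply: continuous_mul; [exact: cvg_cst|exact: continuous_ln].
apply: ccont_ReIm.
  have -> : (fun s => complex.Re (cpow_pos s z)) = (fun s =>
      expR (complex.Re z * ln s) * cos (complex.Im z * ln s)).
    by apply/funext => y; rewrite cpow_posE.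
  by apply: continuous_mul; apply: cln; [exact: continuous_expR|exact: continuous_cos].
have -> : (fun s => complex.Im (cpow_pos s z)) = (fun s =>
    expR (complex.Re z * ln s) * sin (complex.Im z * ln s)).
  by apply/funext => y; rewrite cpow_posE.
by apply: continuous_mul; apply: cln; [exact: continuous_expR|exact: continuous_sin].
Qed.

End ComplexLimits.

(** * Iterating the reciprocity relation *)

Section Reciprocity.
Variables (R : realType) (k : R[i]) (f : rat -> R[i]) (h : R -> R[i]).
Local Notation nm := (@Normc.normc R).
Local Notation w t := (cpow_pos t (- k)).
Hypothesis k0 : complex.Re k < 0.
Hypothesis f_periodic : forall x : rat, ~ (-1 <= x <= 0) -> f x = f (x + 1).
Hypothesis f_recip : forall x : rat, x != 0 -> -1 <= x <= 1 ->
  h (ratr x) = f x - w `|ratr x : R| * f (- x^-1).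
Hypothesis h_cont : forall x, x != 0 -> ccont h x.

(* [f] as a function of a real variable, meaningful at rational points only. *)
Definition f_real (r : R) : R[i] := f (xget 0 [set q | ratr q = r]).

Lemma f_realE (q : rat) : f_real (ratr q) = f q.
Proof.
rewrite /f_real; congr f; apply: (fmorph_inj (@ratr R)).
by apply: (@xgetPex _ 0 [set p | ratr p = ratr q :> R]); exists q.
Qed.

(** The sign treats positive and negative arguments at once; the weight sees only the absolute
    value. *)
Lemma f_real_recip n (r : R) : rational r -> 0 < r -> r <= 1 ->
  f_real ((-1) ^+ n * r) =
  h ((-1) ^+ n * r) + w r * f_real (- ((-1) ^+ n * r^-1)).
Proof.
move=> [q _ <-]; rewrite -[X in X < _ -> _](rmorph0 (@ratr R)) ltr_rat => q0.
rewrite -[X in _ <= X](rmorph1 (@ratr R)) ler_rat => q1.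
have -> : (-1) ^+ n * ratr q = ratr ((-1) ^+ n * q) :> R.
  by rewrite rmorphM rmorph_sign.
have -> : - ((-1) ^+ n * (ratr q)^-1) = ratr (- ((-1) ^+ n * q)^-1) :> R.
  by rewrite rmorphN fmorphV rmorphM rmorph_sign [in RHS]invfM invr_sign.
rewrite !f_realE f_recip; last 2 first.
- by rewrite mulf_neq0 ?signr_eq0 ?gt_eqF.
- rewrite -ler_norml normrM normrX normrN1 expr1n mul1r ger0_norm//.
  exact: ltW.
have -> : `|ratr ((-1) ^+ n * q) : R| = ratr q.
  rewrite rmorphM rmorph_sign normrM normrX normrN1 expr1n mul1r ger0_norm//.
  by rewrite ler0q ltW.
by rewrite subrK.
Qed.

(** For [r > 0] neither [r] nor [- (r + 1)] lies in the excluded interval [[-1, 0]]. *)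
Lemma f_realD1 n (r : R) : rational r -> 0 < r ->
  f_real ((-1) ^+ n * (r + 1)) = f_real ((-1) ^+ n * r).
Proof.
move=> [q _ <-]; rewrite -[X in X < _ -> _](rmorph0 (@ratr R)) ltr_rat => q0.
have -> : (-1) ^+ n * ratr q = ratr ((-1) ^+ n * q) :> R.
  by rewrite rmorphM rmorph_sign.
have -> : (-1) ^+ n * (ratr q + 1) = ratr ((-1) ^+ n * (q + 1)) :> R.
  by rewrite rmorphM rmorphD rmorph1 rmorph_sign.
rewrite !f_realE -signr_odd; case: (odd n); rewrite ?expr0 ?expr1 ?mul1r ?mulN1r.
  rewrite f_periodic; first by rewrite opprD subrK.
  by rewrite lerNl opprK => /andP[]; rewrite leNgt ltrDr q0.
rewrite [RHS]f_periodic// => /andP[_].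
by rewrite leNgt q0.
Qed.

Lemma f_realDn n (r : R) m : rational r -> 0 < r ->
  f_real ((-1) ^+ n * (m%:R + r)) = f_real ((-1) ^+ n * r).
Proof.
move=> rq r0; elim: m => [|m IH]; first by rewrite add0r.
rewrite -natr1 addrAC f_realD1 ?IH ?ltr_wpDl//.
by apply: rationalD => //; exact: (rational_int _ m).
Qed.

Definition qprod (y : R) n := \prod_(i < n) w (frc y i).

(* The three cases express [f y - w z * f (- z^-1)], for [z] the fractional part
   of [y], through values of [h]; the last one uses the reciprocity relation at
   [- (1 - z) / z], since [z / (1 - z)] lies outside of [[-1, 1]]. *)
Definition first_term (y : R) : R[i] :=
  let z := frc y 0 in
  if 0 < y then h z
  else if z <= 2^-1 then h (z - 1) + w (1 - z) * h (z / (1 - z))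
  else h (z - 1) - w z * h (- ((1 - z) / z)).

Definition cocycle_term (y : R) l : R[i] :=
  if l is l'.+1 then qprod y l * h ((-1) ^+ l * frc y l) else first_term y.

Lemma cpow_pos_one_sub (z : R) : 0 < z -> z < 1 -> w (1 - z) * w (z / (1 - z)) = w z.
Proof.
move=> z0 z1; have z'0 : 0 < 1 - z by rewrite subr_gt0.
have zE : (1 - z) * (z / (1 - z)) = z by rewrite mulrC divfK// gt_eqF.
by rewrite -[in RHS]zE [in RHS]cpow_posM// divr_gt0.
Qed.

Lemma f_real_first (y : R) : rational y -> frc y 0 != 0 ->
  f_real y = first_term y + w (frc y 0) * f_real (- cf_tail y 1).
Proof.
move=> yq zn0; have zq := rational_frc (0)%N yq.
rewrite /first_term cf_tailS; have yE := cf_tailE y 0.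
have z1 := frc_lt1 y 0; have z0 : 0 < frc y 0 by rewrite lt_neqAle eq_sym zn0 frc_ge0.
move: zq z0 z1 yE; rewrite /=; set z := frc y 0 => zq z0 z1 yE.
have fz := f_real_recip 0 zq z0 (ltW z1); rewrite !mul1r in fz.
have y0 : cf_digit y 0 = Num.floor y by [].
case: ifPn => [yp|yn].
  have : 0 <= cf_digit y 0 by rewrite y0 floor_ge0 ltW.
  case: (cf_digit y 0) yE => // d yE _.
  by rewrite -fz yE; have := @f_realDn 0 z d zq z0; rewrite !mul1r.
have : cf_digit y 0 < 0.
  rewrite y0 floor_lt0 lt_neqAle leNgt yn andbT; apply: contra zn0 => /eqP y00.
  by rewrite /z /frc /cf_digit /= y00 floor0 subr0.
case: (cf_digit y 0) yE => // d yE _.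
have z'q : rational (1 - z) by apply: rationalD; [exact: (rational_int _ 1)|exact: rationalN].
have z'0 : 0 < 1 - z by rewrite subr_gt0.
have -> : f_real y = f_real (- (1 - z)).
  have := @f_realDn 1 (1 - z) d z'q z'0; rewrite !expr1 !mulN1r => <-.
  have dE : (Negz d)%:~R = - (d%:R + 1) :> R by rewrite NegzE mulrNz natr1.
  by congr f_real; rewrite yE dE; ring.
have z'1 : 1 - z <= 1 by rewrite gerBl ltW.
have := f_real_recip 1 z'q z'0 z'1; rewrite !expr1 !mulN1r opprK => ->.
rewrite opprB -addrA.
pose u := z / (1 - z).
have u0 : 0 < u by rewrite divr_gt0.
have zV1 : 0 < z^-1 - 1 by rewrite subr_gt0 invf_gt1.
have zV1q : rational (z^-1 - 1).
  by apply: rationalD; [exact: rationalV|exact: (rational_int _ (-1))].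
have fzV : f_real (- z^-1) = f_real (- (z^-1 - 1)).
  by have := @f_realDn 1 _ 1 zV1q zV1; rewrite !expr1 !mulN1r addrC subrK.
have uV : u^-1 = z^-1 - 1 by rewrite /u; field; rewrite !gt_eqF.
have uq : rational u by rewrite -[u]invrK uV; exact: rationalV.
have -> : f_real (1 - z)^-1 = f_real u.
  have := @f_realDn 0 u 1 uq u0; rewrite !mul1r => <-; congr f_real.
  by rewrite /u; field; rewrite !gt_eqF.
rewrite -(cpow_pos_one_sub z0 z1) -/u fzV -uV.
case: ifPn => [zh|zh].
  have u1 : u <= 1 by rewrite ler_pdivrMr// mul1r; lra.
  have := f_real_recip 0 uq u0 u1; rewrite !mul1r => ->.
  ring.
(* For [u > 1] reciprocity is applied at [- u^-1] and solved for [f_real u], using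
   [w u * w u^-1 = 1]. *)
have v1 : u^-1 <= 1.
  by rewrite invf_le1// ler_pdivlMr// mul1r; rewrite -ltNge in zh; lra.
have v0 : 0 < u^-1 by rewrite invr_gt0.
have := f_real_recip 1 (rationalV uq) v0 v1; rewrite !expr1 !mulN1r opprK invrK => ->.
have wu : w u * w u^-1 = 1.
  by rewrite -cpow_posM// mulfV ?gt_eqF// cpow_pos1.
rewrite (_ : (1 - z) / z = u^-1); last by rewrite /u invf_div.
rewrite -[X in _ + w (1 - z) * X](mul1r (f_real u)) -wu.
ring.
Qed.

(** Each step strips a digit by periodicity and inverts the fractional part by reciprocity, which
    flips the sign. *)
Lemma f_real_expansion (y : R) N : rational y ->
  (forall i, (i <= N)%N -> frc y i != 0) ->
  f_real y = \sum_(l < N.+1) cocycle_term y l +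
    qprod y N.+1 * f_real ((-1) ^+ N.+1 * cf_tail y N.+1).
Proof.
move=> yq; elim: N => [|N IH] yn.
  rewrite big_ord1 /qprod big_ord1 expr1 mulN1r; exact: f_real_first (yn 0 _).
rewrite IH; last by move=> i iN; apply: yn; exact: leqW.
rewrite (cf_tailS y N.+1); set T := cf_tail y N.+1.
rewrite [in RHS]big_ord_recr/= -addrA; congr (_ + _).
rewrite [qprod y N.+2]/qprod big_ord_recr/= -/(qprod y N.+1) -mulrA -mulrDr; congr (_ * _).
have zn0 := yn N.+1 (leqnn _).
have zq := rational_frc (N.+1)%N yq.
have z0 : 0 < frc y N.+1 by rewrite lt_neqAle eq_sym zn0 frc_ge0.
have := cf_digit_ge1 (yn N (leqW (leqnn _))); have : T = _ := cf_tailE y N.+1.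
case: (cf_digit y N.+1) => // d -> _.
rewrite f_realDn// f_real_recip//; last exact/ltW/frc_lt1.
by rewrite [(-1) ^+ N.+2]exprS mulN1r mulNr.
Qed.

(* Half of the exponential rate at which [qprod] decays; the other half absorbs
   the growth of [h] along the orbit. *)
Definition decay : R := - complex.Re k * ln (4 / 3) / 2.

Lemma decay_gt0 : 0 < decay.
Proof. by rewrite divr_gt0// mulr_gt0 ?oppr_gt0// ln_gt0//; lra. Qed.

(** This is [prod_frc_le] raised to the power [- Re k], as [2 * decay = - Re k * ln (4 / 3)]. *)
Lemma normcR_qprod_le (y : R) n : (forall i, (i < n)%N -> frc y i != 0) ->
  nm (qprod y n) <= (4 / 3) `^ (- complex.Re k) * expR (- (2 * decay * n%:R)).
Proof.
move=> yn.
have -> : nm (qprod y n) = (\prod_(i < n) frc y i) `^ (- complex.Re k).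
  elim: n yn => [|n IH] yn; first by rewrite /qprod !big_ord0 powR1 Normc.normc1.
  rewrite /qprod !big_ord_recr/= Normc.normcM -/(qprod y n).
  rewrite IH; last by move=> i /leqW; exact: yn.
  rewrite powRM ?prod_frc_ge0 ?frc_ge0//; congr (_ * _).
  rewrite normcR_cpow_pos; last by rewrite lt_neqAle eq_sym yn// frc_ge0.
  by case: (k).
have -> : expR (- (2 * decay * n%:R)) = ((3 / 4) ^+ n) `^ (- complex.Re k).
  have -> : (3 / 4 : R) = expR (- ln (4 / 3)).
    by rewrite expRN lnK ?posrE ?divr_gt0// invf_div.
  by rewrite -expRM_natl -expRM /decay; congr expR; field.
rewrite -powRM; [|lra|by apply: exprn_ge0; lra].
apply: ge0_ler_powR; last exact: prod_frc_le.
- by rewrite oppr_ge0 ltW.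
- by rewrite nnegrE prod_frc_ge0.
- by rewrite nnegrE mulr_ge0 ?exprn_ge0 ?divr_ge0.
Qed.

(** * Dominated points and the remainder of the expansion *)

Variables (C : R) (L : nat).
Hypothesis C0 : 0 <= C.

(** Only indices at which the orbit has not yet vanished are tested, hence finitely many at a
    rational point. *)
Definition dominated (y : R) := forall l, (L <= l)%N ->
  (forall i, (i <= l.+1)%N -> frc y i != 0) ->
  nm (h ((-1) ^+ l.+1 * frc y l.+1)) <= C * expR (decay * l.+1%:R).

Let rho := expR (- decay).
Let D := nm (f_real 1) + nm (f_real (-1)).

(** The geometric series of the dominated terms gives [C / (1 - rho)]; [D] bounds [f] at 1 and -1,
    where the expansion of a rational ends. *)
Definition remainder_cst : R := (4 / 3) `^ (- complex.Re k) * (C / (1 - rho) + D).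

(** Induction on the number [d] of steps left before the orbit vanishes, so the bound does not
    depend on the length of the expansion. *)
Lemma remainder_le (y : R) N : rational y -> dominated y -> (L <= N)%N ->
  (forall i, (i <= N)%N -> frc y i != 0) ->
  nm (qprod y N.+1 * f_real ((-1) ^+ N.+1 * cf_tail y N.+1)) <=
    remainder_cst * rho ^+ N.+1.
Proof.
move=> yq yd; have [m Nm fm0] := frc_terminates N.+1 yq.
rewrite -(subnKC Nm) in fm0; move: (m - N.+1)%N fm0 => d {m Nm}.
have rho0 : 0 < rho by exact: expR_gt0.
have rho1 : rho < 1 by rewrite -expR0 ltr_expR oppr_lt0 decay_gt0.
pose K : R := (4 / 3) `^ (- complex.Re k).
have K0 : 0 <= K by exact: powR_ge0.
have D0 : 0 <= D by rewrite addr_ge0// normcR_ge0.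
have rho'0 : 0 < 1 - rho by rewrite subr_gt0.
have rhoE n : rho ^+ n = expR (- (decay * n%:R)).
  by rewrite /rho -expRM_natl; congr expR; ring.
have WN M : (forall i, (i <= M)%N -> frc y i != 0) ->
    nm (qprod y M.+1) <= K * expR (- (2 * decay * M.+1%:R))
  by move=> yn; apply: normcR_qprod_le => i; rewrite ltnS; exact: yn.
(* When the orbit stops, the last quotient is a positive integer, and periodicity moves the argument
   to 1 or -1. *)
have stop M : (forall i, (i <= M)%N -> frc y i != 0) -> frc y M.+1 = 0 ->
    nm (qprod y M.+1 * f_real ((-1) ^+ M.+1 * cf_tail y M.+1)) <=
    remainder_cst * rho ^+ M.+1.
  move=> yn fN; have := cf_digit_ge1 (yn M (leqnn _)); have := cf_tailE y M.+1.
  rewrite fN addr0; case: (cf_digit y M.+1) => // -[//|n] -> _.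
  have -> : f_real ((-1) ^+ M.+1 * n.+1%:~R) = f_real ((-1) ^+ M.+1).
    have := f_realDn M.+1 n (rational_int _ 1) ltr01.
    by rewrite mulr1 natr1.
  have fD : nm (f_real ((-1) ^+ M.+1)) <= C / (1 - rho) + D.
    apply: (@le_trans _ _ D); last by rewrite lerDr divr_ge0// ltW.
    rewrite /D -signr_odd; case: (odd _); rewrite ?expr0 ?expr1.
      by rewrite lerDr normcR_ge0.
    by rewrite lerDl normcR_ge0.
  rewrite Normc.normcM /remainder_cst -/K mulrAC; apply: ler_pM; rewrite ?normcR_ge0//.
  apply: (le_trans (WN M yn)); rewrite ler_wpM2l// rhoE ler_expR lerN2.
  by rewrite ler_wpM2r// ler_peMl ?ltW ?decay_gt0//; lra.
elim: d N => [|d IH] N fd LN yn; first by apply: stop => //; rewrite -[N.+1]addn0.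
have [fN|fN] := eqVneq (frc y N.+1) 0; first exact: stop.
have yn' i : (i <= N.+1)%N -> frc y i != 0.
  by rewrite leq_eqVlt => /predU1P[->//|]; exact: yn.
have step : qprod y N.+1 * f_real ((-1) ^+ N.+1 * cf_tail y N.+1) =
    cocycle_term y N.+1 + qprod y N.+2 * f_real ((-1) ^+ N.+2 * cf_tail y N.+2).
  have := f_real_expansion yq yn'; rewrite (f_real_expansion yq yn).
  by rewrite [X in _ = X + _]big_ord_recr -addrA => /addrI.
rewrite step; apply: (le_trans (normcR_add _ _)).
have {}IH := IH N.+1 _ (leqW LN) yn'; rewrite addSnnS in IH.
have {IH} := IH fd; have := yd N LN yn'; have := WN N yn.
rewrite [cocycle_term _ _]/= [nm (_ * h _)]Normc.normcM.
move: (nm (qprod _ _ * _)) (nm (qprod _ _)) (normcR_ge0 (qprod y N.+1))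
  (nm (h _)) (normcR_ge0 (h ((-1) ^+ N.+1 * frc y N.+1))).
move=> r a a0 b b0 aK bC rR.
(* The growth allowed to [h] cancels half of the decay of the weight, leaving [rho ^+ N.+1]. *)
have ab : a * b <= K * C * rho ^+ N.+1.
  apply: (le_trans (ler_pM a0 b0 aK bC)).
  rewrite mulrACA -expRD rhoE; apply: ler_wpM2l; first exact: mulr_ge0.
  by rewrite ler_expR; lra.
apply: (le_trans (lerD ab rR)).
rewrite [rho ^+ N.+2]exprS /remainder_cst -/K.
have p0 : 0 <= K * rho ^+ N.+1 by rewrite mulr_ge0// exprn_ge0// ltW.
(* The constant is stable under a step because [X = C / (1 - rho)] solves [C + rho * X = X]. *)
have : C + rho * (C / (1 - rho) + D) <= C / (1 - rho) + D.
  have XE : C / (1 - rho) = C + rho * (C / (1 - rho)).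
    by field; rewrite gt_eqF.
  have : rho * D <= D by rewrite ler_piMl// ltW.
  by move: XE; set X := C / _; lra.
move=> /(ler_wpM2l p0); set X := C / _; lra.
Qed.

(** * Continuity of the expansion at irrational points *)

Lemma near_frc_neq0 (x : R) N : irrational x ->
  \forall y \near x, forall i, (i <= N)%N -> frc y i != 0.
Proof.
move=> xi; have near1 i : \forall y \near x, frc y i != 0.
  have zc : {for x, continuous (@frc R ^~ i)} by exact: continuous_frc.
  exact: (cvgr_neq0 _ zc (frc_neq0 i xi)).
elim: N => [|N IH]; first by apply: filterS (near1 0%N) => y y0 i; case: i.
apply: filterS2 IH (near1 N.+1) => y yN yN1 i.
by rewrite leq_eqVlt => /predU1P[->//|]; exact: yN.
Qed.

Lemma ccont_w_frc (x : R) n : irrational x -> ccont (fun y => w (frc y n)) x.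
Proof.
move=> xi; apply: (@ccont_comp _ (fun t => w t) (@frc R ^~ n)).
  exact: continuous_frc.
by apply: ccont_cpow_pos; exact: frc_gt0.
Qed.

Lemma ccont_h_comp (g : R -> R) (x : R) : {for x, continuous g} -> g x != 0 ->
  ccont (fun y => h (g y)) x.
Proof. by move=> gc gx; apply: ccont_comp => //; exact: h_cont. Qed.

(** The cases of [first_term] change only where [y = 0] or [frc y 0 = 1/2], which an irrational
    point avoids; elsewhere one formula holds locally. *)
Lemma ccont_first_term (x : R) : irrational x -> ccont first_term x.
Proof.
move=> xi; have z0 := frc_gt0 0 xi; have z1 := frc_lt1 x 0.
have zc : {for x, continuous (@frc R ^~ 0%N)} by exact: continuous_frc.
have z'0 : 1 - frc x 0 != 0 by rewrite subr_eq0 gt_eqF.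
have z'c : {for x, continuous (fun y => 1 - frc y 0)}.
  by apply: continuous_sub => //; exact: cvg_cst.
have hz1 : ccont (fun y => h (frc y 0 - 1)) x.
  apply: ccont_h_comp; last by rewrite subr_eq0 lt_eqF.
  by apply: continuous_sub => //; exact: cvg_cst.
case: (ltP 0 x) => x0.
  apply: (@ccont_near _ _ (fun y => h (frc y 0))); last first.
    by apply: ccont_h_comp => //; exact: frc_neq0.
  near=> y; rewrite /first_term ifT//.
  by near: y; exact: lt_nbhsr.
have {}x0 : x < 0 by rewrite lt_neqAle x0 irrational_neq0.
have yneg : \forall y \near x, (0 < y) = false.
  near=> y; apply/negbTE; rewrite -leNgt ltW//.
  by near: y; exact: lt_nbhsl.
have [zh|zh|zh] := ltgtP (frc x 0) 2^-1; last first.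
- exfalso; apply: (irrational_frc (n := 0) xi); rewrite zh.
  by apply: rationalV; exact: (rational_int _ 2).
- apply: (@ccont_near _ _ (fun y =>
    h (frc y 0 - 1) - w (frc y 0) * h (- ((1 - frc y 0) / frc y 0)))).
    near=> y; rewrite /first_term (_ : (0 < y) = false); last by near: y.
    rewrite leNgt (_ : 2^-1 < frc y 0)//.
    by near: y; exact: (cvgr_gt _ zc _ zh).
  apply: ccontD => //; apply: ccontN; apply: ccontM; first exact: ccont_w_frc.
  apply: ccont_h_comp; last by rewrite oppr_eq0 mulf_neq0// invr_neq0// frc_neq0.
  by apply: continuous_opp; apply: continuous_div => //; exact: frc_neq0.
- apply: (@ccont_near _ _ (fun y =>
    h (frc y 0 - 1) + w (1 - frc y 0) * h (frc y 0 / (1 - frc y 0)))).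
    near=> y; rewrite /first_term (_ : (0 < y) = false); last by near: y.
    rewrite (_ : frc y 0 <= 2^-1)// ltW//.
    by near: y; exact: (cvgr_lt _ zc _ zh).
  apply: ccontD => //; apply: ccontM.
    apply: (@ccont_comp _ (fun t => w t) (fun y => 1 - frc y 0)) => //.
    by apply: ccont_cpow_pos; rewrite subr_gt0.
  apply: ccont_h_comp; last by rewrite mulf_neq0 ?invr_neq0// frc_neq0.
  exact: continuous_div.
Unshelve. all: by end_near. Qed.

Lemma ccont_cocycle_term (x : R) l : irrational x -> ccont (cocycle_term ^~ l) x.
Proof.
move=> xi; case: l => [|l]; first exact: ccont_first_term.
apply: ccontM.
  by apply: (@ccont_prod _ (fun i y => w (frc y i))) => i _; exact: ccont_w_frc.
apply: ccont_h_comp; last by rewrite mulf_neq0 ?signr_eq0 ?frc_neq0.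
by apply: continuous_mul; [exact: cvg_cst|exact: continuous_frc].
Qed.

(** A cut-off [N] makes the remainder small uniformly over dominated points, and the partial sum up
    to [N] is continuous at [x]. *)
Lemma dominated_cauchy (x e : R) : irrational x -> 0 < e ->
  exists d, 0 < d /\ forall q r : rat,
    `|ratr q - x| < d -> `|ratr r - x| < d ->
    dominated (ratr q) -> dominated (ratr r) -> nm (f q - f r) < e.
Proof.
move=> xi e0; have e4 : 0 < e / 4 by rewrite divr_gt0.
have rho0 : 0 < rho by exact: expR_gt0.
have rho1 : rho < 1 by rewrite -expR0 ltr_expR oppr_lt0 decay_gt0.
have M0 : 0 <= remainder_cst.
  by rewrite mulr_ge0 ?powR_ge0// addr_ge0 ?divr_ge0 ?subr_ge0 ?addr_ge0 ?normcR_ge0// ltW.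
have [N LN HN] : exists2 N, (L <= N)%N & remainder_cst * rho ^+ N.+1 < e / 4.
  have : GRing.exp rho @ \oo --> (0 : R) by apply: cvg_expr; rewrite gtr0_norm.
  (* Adding 1 keeps the divisor positive when [remainder_cst] is 0. *)
  move/cvgrPdist_lt => /(_ (e / 4 / (remainder_cst + 1))).
  rewrite divr_gt0 ?ltr_wpDl// => /(_ isT)[N _ HN].
  exists (maxn L N); first exact: leq_maxl.
  have := HN (maxn L N).+1 (leq_trans (leq_maxr _ _) (leqnSn _)).
  rewrite sub0r normrN ger0_norm ?exprn_ge0 ?(ltW rho0)// ltr_pdivlMr ?ltr_wpDl//.
  apply: le_lt_trans; rewrite mulrC ler_wpM2l ?exprn_ge0 ?(ltW rho0)//.
  by rewrite lerDl.
pose S y := \sum_(l < N.+1) cocycle_term y l.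
have Sc : ccont S x.
  by apply: (@ccont_sum _ (fun l y => cocycle_term y l)) => l _; exact: ccont_cocycle_term.
have : \forall y \near x, nm (S y - S x) < e / 4 /\ (forall i, (i <= N)%N -> frc y i != 0).
  by near=> y; split; near: y; [exact: Sc|exact: near_frc_neq0].
move=> /nbhs_ballP[d /= d0 H]; exists d; split => // q r qx rx qd rd.
have rem (p : rat) : `|ratr p - x| < d -> dominated (ratr p) -> nm (f p - S x) < e / 2.
  move=> px pd; have [|Sp pn] := H (ratr p); first by rewrite /ball/= distrC.
  rewrite -(f_realE p) (f_real_expansion (rational_ratr R p) pn) addrAC.
  apply: (le_lt_trans (normcR_add _ _)); rewrite (_ : e / 2 = e / 4 + e / 4); last by lra.
  apply: ltrD => //; apply: le_lt_trans HN.
  exact: remainder_le (rational_ratr R p) pd LN pn.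
apply: (le_lt_trans (normcR_dist_trans _ (S x) _)); rewrite [e]splitr [nm (S x - _)]normcR_sub.
by apply: ltrD; exact: rem.
Unshelve. all: by end_near. Qed.

End Reciprocity.

(** * The limit function *)

Lemma ccont_of_modulus (R : realType) (delta : R) (h : R -> R[i]) :
  (forall eta : R, 0 < eta -> exists eps0 : R, 0 < eps0 /\
     forall eps : R, 0 < eps -> eps < eps0 ->
       forall x y : R, x != 0 -> y != 0 ->
         `|x - y| < expR (- powR eps (delta - 1)) -> 2 * eps < `|x| ->
         `|h x - h y| <= eta%:C) ->
  forall x, x != 0 -> ccont h x.
Proof.
move=> H x x0 e e0; have e2 : 0 < e / 2 by rewrite divr_gt0.
have [eps0 [eps00 {}H]] := H _ e2.
have xp : 0 < `|x| by rewrite normr_gt0.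
(* A third of the minimum gives both [eps < eps0] and [2 * eps < |x|]. *)
pose eps := Num.min eps0 `|x| / 3.
have m0 : 0 < Num.min eps0 `|x| by rewrite lt_min eps00.
have epsp : 0 < eps by rewrite divr_gt0.
have m1 : Num.min eps0 `|x| <= eps0 by rewrite ge_min lexx.
have m2 : Num.min eps0 `|x| <= `|x| by rewrite ge_min lexx orbT.
have eps_lt : eps < eps0 by rewrite /eps; lra.
have eps_x : 2 * eps < `|x| by rewrite /eps; lra.
have idc : {for x, continuous (@id R)} by exact: cvg_id.
have close : \forall y \near x, `|x - y| < expR (- eps `^ (delta - 1)).
  by move/cvgrPdist_lt: idc => /(_ _ (expR_gt0 _)); apply.
near=> y; have y0 : y != 0 by near: y; exact: (cvgr_neq0 _ idc x0).
have xy : `|x - y| < expR (- eps `^ (delta - 1)) by near: y; exact: close.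
have : Normc.normc (h x - h y) <= e / 2.
  by rewrite -normcR_le; apply: (H eps).
by rewrite normcR_sub => hxy; apply: (le_lt_trans hxy); lra.
Unshelve. all: by end_near. Qed.

(* The exponent [delta - 1] of the growth condition may be taken in [(-1, 0)]. *)
Lemma growth_exponent (R : realType) (delta C : R) (h : R -> R[i]) : 0 < delta ->
  (forall x : R, x != 0 -> `|x| <= 1 ->
     `|h x| <= (C * expR (powR `|x| (delta - 1)))%:C) ->
  exists r C' : R, [/\ 0 < r, r < 1, 0 <= C' & forall x : R, x != 0 -> `|x| <= 1 ->
     Normc.normc (h x) <= C' * expR (powR `|x| (- r))].
Proof.
move=> delta0 hC.
have {}hC (x : R) : x != 0 -> `|x| <= 1 ->
    Normc.normc (h x) <= C * expR (powR `|x| (delta - 1)).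
  by move=> x0 x1; rewrite -normcR_le; exact: hC.
have C0 : 0 <= C.
  have := hC 1 (oner_neq0 _); rewrite normr1 => /(_ (lexx _)).
  move/(le_trans (normcR_ge0 _)); rewrite pmulr_lge0//; exact: expR_gt0.
have [d1|d1] := ltP delta 1.
  exists (1 - delta), C; split => //; [lra|lra|].
  by move=> x x0 x1; rewrite opprB; exact: hC.
(* For [delta >= 1] the power is at most 1, so [|h|] is at most [C * e] on [[-1, 1]] away from 0,
   and [1/2] is an arbitrary choice in [(0, 1)]. *)
exists 2^-1, (C * expR 1); split; [lra|lra|by rewrite mulr_ge0 ?expR_ge0|].
move=> x x0 x1; apply: (le_trans (hC x x0 x1)).
rewrite -mulrA; apply: ler_wpM2l => //; rewrite -expRD ler_expR.
apply: (@le_trans _ _ 1); last by rewrite lerDl powR_ge0.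
rewrite -[leRHS](powRr0 `|x|); apply: ger_powR; last by rewrite subr_ge0.
by rewrite normr_gt0 x0.
Qed.

Lemma norm_sign_frc (R : realType) (x : R) n l :
  `|(-1) ^+ n * frc x l| = frc x l.
Proof. by rewrite normrM normrX normrN1 expr1n mul1r ger0_norm ?frc_ge0. Qed.

Section LimitFunction.
Variables (R : realType) (k : R[i]) (f : rat -> R[i]) (h : R -> R[i]).
Local Notation nm := (@Normc.normc R).
Hypothesis k0 : complex.Re k < 0.
Hypothesis f_periodic : forall x : rat, ~ (-1 <= x <= 0) -> f x = f (x + 1).
Hypothesis f_recip : forall x : rat, x != 0 -> -1 <= x <= 1 ->
  h (ratr x) = f x - cpow_pos `|ratr x : R| (- k) * f (- x^-1).
Hypothesis h_cont : forall x, x != 0 -> ccont h x.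
Variables (tau : nat -> R) (r C : R).
Hypothesis C0 : 0 <= C.
Hypothesis h_le : forall x : R, x != 0 -> `|x| <= 1 ->
  nm (h x) <= C * expR (`|x| `^ (- r)).
Hypothesis tau_le : forall l v, 0 < v -> tau l / 2 <= v ->
  v `^ (- r) <= decay k * l.+1%:R.

Local Notation dom C L x := (dominated k h C L x).

(** The orbit of a convergent is at least half that of [x], hence at least [tau l / 2], the level at
    which [tau_le] applies. *)
Lemma dominated_convergent L x j : frc_ge tau L x -> dom C L (ratr (convergent x j)).
Proof.
move=> [xi xL] l Ll; set q : R := ratr _ => qn.
have ql0 : 0 < frc q l.+1 by rewrite lt_neqAle eq_sym qn// frc_ge0.
apply: (le_trans (h_le _ _)).
- by rewrite mulf_neq0 ?signr_eq0// qn.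
- by rewrite norm_sign_frc ltW// frc_lt1.
rewrite norm_sign_frc; apply: ler_wpM2l => //; rewrite ler_expR.
apply: tau_le => //; apply: le_trans (frc_convergent_ge xi qn).
by rewrite ler_wpM2r ?invr_ge0// xL.
Qed.

Lemma dominated_le B L x : C <= B -> dom C L x -> dom B L x.
Proof.
move=> CB xd l Ll xn; apply: (le_trans (xd l Ll xn)).
by rewrite ler_wpM2r ?expR_ge0.
Qed.

Lemma dominated_bounded B L x : 0 <= B -> (forall y, nm (h y) <= B) -> dom B L x.
Proof.
move=> B0 hB l _ _; apply: (le_trans (hB _)).
rewrite -[leLHS]mulr1 ler_wpM2l// -expR0 ler_expR.
by rewrite mulr_ge0// ltW// decay_gt0.
Qed.

Lemma convergent_near (x d : R) : irrational x -> 0 < d ->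
  exists N, forall j, (N <= j)%N -> `|ratr (convergent x j) - x| < d.
Proof.
move=> xi d0.
have : GRing.exp (3 / 4 : R) @ \oo --> (0 : R).
  by apply: cvg_expr; rewrite ger0_norm; lra.
move/cvgrPdist_lt => /(_ (d / (4 / 3))).
rewrite divr_gt0// ?divr_gt0// => /(_ isT)[N _ HN]; exists N => j Nj.
apply: (le_lt_trans (dist_convergent xi j)).
have := HN j Nj; rewrite sub0r normrN ger0_norm; last by apply: exprn_ge0; lra.
lra.
Qed.

(** The limit along convergents, with default value 0 where it does not exist; it is independent of
    [L]. *)
Definition fdag (x : R) : R[i] := xget 0 [set z | forall e : R, 0 < e ->
  exists N, forall j, (N <= j)%N -> nm (f (convergent x j) - z) < e].

Lemma fdagP L x : frc_ge tau L x -> forall e : R, 0 < e ->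
  exists N, forall j, (N <= j)%N -> nm (f (convergent x j) - fdag x) < e.
Proof.
move=> xL; have [xi _] := xL.
suff [z zlim] : exists z, forall e : R, 0 < e ->
    exists N, forall j, (N <= j)%N -> nm (f (convergent x j) - z) < e.
  exact: (@xgetPex _ 0 [set z | forall e : R, 0 < e ->
    exists N, forall j, (N <= j)%N -> nm (f (convergent x j) - z) < e] (ex_intro _ z zlim)).
apply: complex_complete => e e0.
have [d [d0 H]] := dominated_cauchy k0 f_periodic f_recip h_cont L C0 xi e0.
have [N HN] := convergent_near xi d0; exists N => i j Ni Nj.
by apply: H; [exact: HN|exact: HN|exact: dominated_convergent|exact: dominated_convergent].
Qed.

(** The larger constant [B] serves bounded [h], where it can be chosen so that every rational is
    dominated. *)
Lemma dominated_fdag B L x e : C <= B -> frc_ge tau L x -> 0 < e ->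
  exists d : R, 0 < d /\ forall q : rat, `|ratr q - x| < d ->
    dom B L (ratr q) -> nm (f q - fdag x) < e.
Proof.
move=> CB xL e0; have [xi _] := xL; have e2 : 0 < e / 2 by rewrite divr_gt0.
have [d [d0 H]] :=
  dominated_cauchy k0 f_periodic f_recip h_cont L (le_trans C0 CB) xi e2.
exists d; split => // q qx qd.
have [N1 HN1] := convergent_near xi d0; have [N2 HN2] := fdagP xL e2.
pose j := maxn N1 N2.
apply: (le_lt_trans (normcR_dist_trans _ (f (convergent x j)) _)); rewrite [e]splitr.
apply: ltrD; last by apply: HN2; exact: leq_maxr.
apply: H => //; first by apply: HN1; exact: leq_maxl.
by apply: dominated_le CB _; exact: dominated_convergent.
Qed.

(** [fdag y] is approximated by [f] at a far convergent of [y], which is dominated with the same [L]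
    and still close to [x]. *)
Lemma fdag_continuous L x e : frc_ge tau L x -> 0 < e ->
  exists d : R, 0 < d /\ forall y, frc_ge tau L y -> `|y - x| < d ->
    nm (fdag y - fdag x) < e.
Proof.
move=> xL e0; have e2 : 0 < e / 2 by rewrite divr_gt0.
have [d [d0 H]] := dominated_fdag (lexx C) xL e2.
exists d; split => // y yL yx.
have yxd : 0 < d - `|y - x| by rewrite subr_gt0.
have [N1 HN1] := convergent_near yL.1 yxd; have [N2 HN2] := fdagP yL e2.
pose j := maxn N1 N2.
apply: (le_lt_trans (normcR_dist_trans _ (f (convergent y j)) _)); rewrite [e]splitr.
apply: ltrD; first by rewrite normcR_sub; apply: HN2; exact: leq_maxr.
apply: H; last exact: dominated_convergent.
have := HN1 j (leq_maxl _ _); have := ler_normD (ratr (convergent y j) - y) (y - x).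
rewrite addrA subrK; lra.
Qed.

(** [fdag] is continuous on each of the countably many measurable pieces; [p] will be the real or
    the imaginary part. *)
Lemma measurable_fdag (p : R[i] -> R) : (forall z1 z2, `|p z1 - p z2| <= nm (z1 - z2)) ->
  measurable_fun (\bigcup_L frc_ge tau L) (p \o fdag).
Proof.
move=> pnm; apply/measurable_fun_bigcup => L; first exact: measurable_frc_ge.
apply: measurable_fun_within; first exact: measurable_frc_ge.
move=> x xL e e0; have [d [d0 H]] := fdag_continuous xL e0.
exists d; split => // y yL yx.
exact: le_lt_trans (pnm _ _) (H y yL yx).
Qed.

End LimitFunction.

Theorem theorem1p2 (R : realType) (k : R[i]) (delta : R)
  (f : rat -> R[i]) (h : R -> R[i]) :
  complex.Re k < 0 -> 0 < delta ->
  (forall x : rat, ~ (-1 <= x <= 0) -> f x = f (x + 1)) ->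
  (forall x : rat, x != 0 -> -1 <= x <= 1 ->
     h (ratr x) = f x - cpow_pos `|ratr x : R| (- k) * f (- x^-1)) ->
  (forall eta : R, 0 < eta -> exists eps0 : R, 0 < eps0 /\
     forall eps : R, 0 < eps -> eps < eps0 ->
       forall x y : R, x != 0 -> y != 0 ->
         `|x - y| < expR (- powR eps (delta - 1)) -> 2 * eps < `|x| ->
         `|h x - h y| <= eta%:C) ->
  (exists C : R, forall x : R, x != 0 -> `|x| <= 1 ->
     `|h x| <= (C * expR (powR `|x| (delta - 1)))%:C) ->
  exists (X : set R) (fdag : R -> R[i]),
    [/\ X `<=` irrational, measurable X,
        (@lebesgue_measure R) (~` X) = 0%E &
        (forall x, X x -> forall e : R, 0 < e -> exists N : nat,
           forall j, (N <= j)%N -> `|f (convergent x j) - fdag x| < e%:C)] /\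
    [/\ ((exists B : R, forall x, `|h x| <= B%:C) ->
           forall x, X x -> forall e : R, 0 < e -> exists d : R, 0 < d /\
             forall q : rat, `|ratr q - x| < d -> `|f q - fdag x| < e%:C),
        (forall eps : R, 0 < eps -> exists Xe : set R,
           [/\ Xe `<=` X, measurable Xe,
               (forall x, Xe x <-> Xe (x + 1)),
               ((1 - eps)%:E <= (@lebesgue_measure R) (Xe `&` `[0%R, 1%R]))%E &
               (forall x, Xe x -> forall e : R, 0 < e -> exists d : R,
                  0 < d /\ forall y, Xe y -> `|y - x| < d ->
                  `|fdag y - fdag x| < e%:C)]) &
        (measurable_fun X (fun x => complex.Re (fdag x)) /\
         measurable_fun X (fun x => complex.Im (fdag x)))].
Proof.
move=> k0 delta0 f_periodic f_recip /ccont_of_modulus h_cont [C hC].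
have [r [C' [r0 r1 C0 h_le]]] := growth_exponent delta0 hC.
have [tau [tau0 tau_tail tau_le]] := summable_thresholds (decay_gt0 k0) r0 r1.
have limP := fdagP k0 f_periodic f_recip h_cont C0 h_le tau_le.
(* [X] consists of the points eventually above the thresholds; each [X_eps] will be a single piece
   [frc_ge tau L]. *)
exists (\bigcup_L frc_ge tau L), (fdag f); split; split.
- by move=> x [L _ []].
- by apply: bigcupT_measurable => L; exact: measurable_frc_ge.
- exact: lebesgue_setC_frc_ge.
- move=> x [L _ xL] e e0; have [N HN] := limP L x xL e e0.
  by exists N => j Nj; rewrite normcR_lt; exact: HN.
- move=> [B hB] x [L _ xL] e e0.
  (* With the constant [Num.max C' B] every rational point is dominated, so the limit runs over all
     rationals. *)
  have C'B : C' <= Num.max C' B by rewrite le_max lexx.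
  have [d [d0 H]] :=
    dominated_fdag k0 f_periodic f_recip h_cont C0 h_le tau_le C'B xL e0.
  exists d; split => // q qx; rewrite normcR_lt; apply: H => //.
  apply: dominated_bounded => //; first exact: le_trans C0 C'B.
  by move=> y; rewrite le_max -!normcR_le hB orbT.
- move=> e e0; have [L HL] := lebesgue_frc_ge01 tau0 tau_tail e0.
  exists (frc_ge tau L); split => //.
  + by move=> x xL; exists L.
  + exact: measurable_frc_ge.
  + by move=> x; exact: frc_geD1.
  + move=> x xL e' e'0; have [d [d0 H]] :=
      fdag_continuous k0 f_periodic f_recip h_cont C0 h_le tau_le xL e'0.
    by exists d; split => // y yL yx; rewrite normcR_lt; exact: H.
- split.
    apply: (measurable_fdag k0 f_periodic f_recip h_cont C0 h_le tau_le) => -[a b] [c d].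
    exact: (normcR_Re ((a +i* b) - (c +i* d))).
  apply: (measurable_fdag k0 f_periodic f_recip h_cont C0 h_le tau_le) => -[a b] [c d].
  exact: (normcR_Im ((a +i* b) - (c +i* d))).
Qed.
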